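(* Let $f_1\in L^2(\Omega_1)$ and $f_2\in L^2(\Omega_2)$. The energy functional $\mathcal{E}:H\to\mathbb{R}$ defined by $$\mathcal{E}(u)=E(u)-\int_{\Omega_1}f_1u_1\,\mathrm{d}x-\int_{\Omega_2}f_2u_2\,\mathrm{d}x$$ is convex and continuous on $H$.
   Context: Setting. Let $n\ge 2$, $s_1,s_2\in(0,1)$, and let $\Omega_1,\Omega_2\subset\mathbb{R}^n$ be open, connected, bounded domains with Lipschitz boundaries and $\overline{\Omega}_1\cap\overline{\Omega}_2=\emptyset$; $d:=\mathrm{dist}(\Omega_1,\Omega_2)>0$. $\Omega^c$ denotes the complement of $\Omega$ in $\mathbb{R}^n$. The kernel $J:\mathbb{R}^n\to\mathbb{R}$ is measurable and satisfies: $J(z)\ge 0$ and $J(z)=J(-z)$ for a.e. $z$; $J\in L^1(\mathbb{R}^n)$; there exists $r>d$ such that $B_r(0)\subset\mathrm{supp}(J)$. For $i\in\{1,2\}$, $\mathcal{C}_i=c(n,s_i)/2$, where $c(n,s_i)>0$ is the normalization constant of the fractional Laplacian $(-\Delta)^{s_i}$ on $\mathbb{R}^n$. Spaces. For $s\in(0,1)$, $\tilde H^s(\Omega)$ is the closure of $C_0^\infty(\Omega)$ in $H^s(\mathbb{R}^n)$ (equivalently, functions of $H^s(\mathbb{R}^n)$ supported in $\overline\Omega$), with norm $|v|_{\tilde H^s(\Omega)}^2=\int_{\mathbb{R}^n}\int_{\mathbb{R}^n}\frac{|v(x)-v(y)|^2}{|x-y|^{n+2s}}\,\mathrm{d}x\,\mathrm{d}y$;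 its elements vanish outside $\Omega$. $H:=\tilde H^{s_1}(\Omega_1)\oplus\tilde H^{s_2}(\Omega_2)=\{u=u_1+u_2:u_i\in\tilde H^{s_i}(\Omega_i)\}$, with norm $|u|_H=(|u_1|^2_{\tilde H^{s_1}(\Omega_1)}+|u_2|^2_{\tilde H^{s_2}(\Omega_2)})^{1/2}$. Energy. For $u=u_1+u_2\in H$, $$E(u)=\frac{\mathcal{C}_1}{2}\int_{\Omega_2^c}\int_{\Omega_2^c}\frac{(u_1(x)-u_1(y))^2}{|x-y|^{n+2s_1}}\,\mathrm{d}y\,\mathrm{d}x+\frac{\mathcal{C}_2}{2}\int_{\Omega_1^c}\int_{\Omega_1^c}\frac{(u_2(x)-u_2(y))^2}{|x-y|^{n+2s_2}}\,\mathrm{d}y\,\mathrm{d}x+\frac12\int_{\Omega_1}\int_{\Omega_2}J(x-y)(u_1(x)-u_2(y))^2\,\mathrm{d}y\,\mathrm{d}x .$$ *)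

(* Defs.v *)
From HB Require Import structures.
From mathcomp Require Import all_boot all_order all_algebra.
From mathcomp Require Import all_classical all_reals all_analysis.
Set Implicit Arguments.
Unset Strict Implicit.
Unset Printing Implicit Defensive.
Import Order.TTheory GRing.Theory Num.Theory.
Import numFieldNormedType.Exports.
Local Open Scope classical_set_scope.
Local Open Scope ring_scope.

(* ['rV[R]_n] carries the sigma-algebra generated by the coordinates, i.e. its
   Borel sigma-algebra. *)
Section rV_measurable.
Context (R : realType) (n : nat).

Definition rV_coord (i : 'I_n) (x : 'rV[R]_n) : measurableTypeR R := x 0 i.

Let rV_measurable0 : g_sigma_preimage rV_coord set0.
Proof. exact: sigma_algebra0. Qed.

Let rV_measurableC A : g_sigma_preimage rV_coord A ->
  g_sigma_preimage rV_coord (~` A).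
Proof. exact: sigma_algebraC. Qed.

Let rV_measurableU (F : (set 'rV[R]_n)^nat) :
  (forall i, g_sigma_preimage rV_coord (F i)) ->
  g_sigma_preimage rV_coord (\bigcup_i F i).
Proof. exact: sigma_algebra_bigcup. Qed.

HB.instance Definition _ := @isMeasurable.Build default_measure_display
  'rV[R]_n (g_sigma_preimage rV_coord)
  rV_measurable0 rV_measurableC rV_measurableU.

End rV_measurable.

Lemma measurable_rV_coord (R : realType) n (i : 'I_n) :
  measurable_fun [set: 'rV[R]_n] (@rV_coord R n i).
Proof.
case: n i => [[]//|n] i _ B mB; rewrite setTI; apply: sub_sigma_algebra.
rewrite -bigcup_mkord_ord; exists (i : nat); first exact: ltn_ord.
by exists B => //; rewrite setTI inord_val.
Qed.

Lemma measurable_row_tail (R : realType) n :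
  measurable_fun [set: 'rV[R]_n.+1]
    (fun x => \row_j x 0 (lift ord0 j) : 'rV[R]_n).
Proof.
apply: (@measurability _ _ _ _ setT _
  (\big[setU/set0]_(i < n)
    preimage_set_system setT (@rV_coord R n i) measurable)) => //.
case: n => [|n] _ [A + <-]; first by rewrite big_ord0.
rewrite -bigcup_mkord_ord => -[k kn [B mB <-]].
rewrite !setTI -comp_preimage -[X in measurable X]setTI.
set g := rV_coord _ \o _.
have -> : g = rV_coord (lift ord0 (inord k)).
  by apply/funext => x; rewrite /g /= /rV_coord mxE.
exact: measurable_rV_coord.
Qed.

Section lebesgue_row_succ.
Context (R : realType) (n : nat).
Local Open Scope ereal_scope.

Definition row_cons (p : measurableTypeR R * 'rV[R]_n) : 'rV[R]_n.+1 :=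
  (\row_i (if unlift ord0 i is Some j then p.2 0 j else p.1))%R.

Lemma measurable_row_cons : measurable_fun [set: _] row_cons.
Proof.
apply: (@measurability _ _ _ _ setT row_cons
  (\big[setU/set0]_(i < n.+1)
    preimage_set_system setT (@rV_coord R n.+1 i) measurable)) => //.
move=> _ [A + <-]; rewrite -bigcup_mkord_ord => -[k kn [B mB <-]].
rewrite !setTI -comp_preimage -[X in measurable X]setTI.
set i := inord k.
suff mi : measurable_fun [set: _] (rV_coord i \o row_cons) by exact: mi.
case: (unliftP ord0 i) => [j ij|i0].
  have -> : rV_coord i \o row_cons = @rV_coord R n j \o snd.
    by apply/funext => p; rewrite /= /rV_coord mxE ij liftK.
  exact: (measurableT_comp (measurable_rV_coord j) measurable_snd).
have -> : rV_coord i \o row_cons = fst; last exact: measurable_fst.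
by apply/funext => p; rewrite /= /rV_coord mxE i0 unlift_none.
Qed.

Variable mu : {sigma_finite_measure set 'rV[R]_n -> \bar R}.

Definition lebesgue_row_succ : set 'rV[R]_n.+1 -> \bar R :=
  pushforward ((@lebesgue_measure R) \x mu) row_cons.

Let succ0 : lebesgue_row_succ set0 = 0.
Proof. by rewrite /lebesgue_row_succ /pushforward preimage_set0 measure0. Qed.

Let succ_ge0 A : 0 <= lebesgue_row_succ A.
Proof. by rewrite /lebesgue_row_succ /pushforward; exact: measure_ge0. Qed.

Let succ_sigma_additive : semi_sigma_additive lebesgue_row_succ.
Proof.
move=> F mF tF mUF; rewrite /lebesgue_row_succ /pushforward preimage_bigcup.
have mpre A : measurable A -> measurable (row_cons @^-1` A).
  by move=> mA; rewrite -[X in measurable X]setTI; exact: measurable_row_cons.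
apply: measure_semi_sigma_additive => [k||]; first exact: mpre.
- apply/trivIsetP => /= i j _ _ ij; rewrite -preimage_setI.
  by move/trivIsetP : tF => /(_ _ _ _ _ ij) ->//; rewrite preimage_set0.
- by rewrite -preimage_bigcup; exact: mpre.
Qed.

HB.instance Definition _ := isMeasure.Build _ _ _
  lebesgue_row_succ succ0 succ_ge0 succ_sigma_additive.

Let row_uncons (x : 'rV[R]_n.+1) : measurableTypeR R * 'rV[R]_n :=
  (rV_coord ord0 x, \row_j x 0%R (lift ord0 j))%R.

Let row_consK : cancel row_cons row_uncons.
Proof.
move=> [a v]; rewrite /row_uncons /rV_coord mxE unlift_none; congr pair.
by apply/rowP => j; rewrite !mxE liftK.
Qed.

Let measurable_row_uncons : measurable_fun [set: _] row_uncons.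
Proof.
apply/measurable_fun_pairP; split; first exact: measurable_rV_coord.
exact: measurable_row_tail.
Qed.

Let succ_sigma_finite : sigma_finite setT lebesgue_row_succ.
Proof.
have /sigma_finiteP[F [TF ndF Foo]] := sigma_finiteT (@lebesgue_measure R).
have /sigma_finiteP[G [TG ndG Goo]] := sigma_finiteT mu.
exists (fun k => row_uncons @^-1` (F k `*` G k)).
  rewrite -preimage_bigcup; apply/seteqP; split => // x _.
  have [k _ Fk] : (\bigcup_k F k) (row_uncons x).1 by rewrite -TF.
  have [l _ Gl] : (\bigcup_k G k) (row_uncons x).2 by rewrite -TG.
  exists (maxn k l) => //; split => /=.
    by move: Fk; exact/subsetPset/ndF/leq_maxl.
  by move: Gl; exact/subsetPset/ndG/leq_maxr.
move=> k; have [mF Fk] := Foo k; have [mG Gk] := Goo k.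
have mFG : measurable (F k `*` G k) by exact: measurableX.
split.
  by rewrite -[X in measurable X]setTI; exact: measurable_row_uncons.
rewrite /lebesgue_row_succ /pushforward.
rewrite (_ : _ @^-1` _ = F k `*` G k); last first.
  by apply/funext => p; rewrite /preimage /mkset row_consK.
by rewrite product_measure1E// lte_mul_pinfty// ge0_fin_numE.
Qed.

HB.instance Definition _ := Measure_isSigmaFinite.Build _ _ _
  lebesgue_row_succ succ_sigma_finite.

End lebesgue_row_succ.

Fixpoint lebesgue_row (R : realType) (n : nat) :
    {sigma_finite_measure set 'rV[R]_n -> \bar R} :=
  if n is m.+1 then lebesgue_row_succ (lebesgue_row R m) else \d_(0 : 'rV[R]_0).

Section euclidean.
Context (R : realType) (n : nat).
Local Notation Rn := 'rV[R]_n.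

(* The library norm on ['rV[R]_n] is the sup norm. *)
Definition enorm m (x : 'rV[R]_m) : R := Num.sqrt (\sum_i x 0 i ^+ 2).

Definition eball (x : Rn) (r : R) : set Rn := [set y | enorm (y - x) < r].

Definition set_dist (A B : set Rn) : \bar R :=
  ereal_inf [set (enorm (p.1 - p.2))%:E | p in A `*` B].

(* Near each boundary point [p], after a rigid motion, [Om] is the part lying
   above the graph of a Lipschitz function of the n - 1 coordinates other than
   the j-th. *)
Definition lipschitz_boundary (Om : set Rn) :=
  forall p : Rn, (closure Om `\` Om°) p ->
  exists (A : 'M[R]_n) (j : 'I_n) (gam : 'rV[R]_n.-1 -> R^o) (L r : R),
    [/\ A *m A^T = 1%:M, 0 < r, L.-lipschitz gam &
      forall x, eball p r x ->
        (Om x <-> gam (col' j ((x - p) *m A)) < ((x - p) *m A) 0 j)].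

Definition lipschitz_domain (Om : set Rn) :=
  [/\ Om !=set0, open Om, connected Om, bounded_set Om & lipschitz_boundary Om].

Definition iter_partial (f : Rn -> R^o) (s : seq 'I_n) : Rn -> R^o :=
  foldr (fun i g => fun x => derive g x (delta_mx 0 i)) f s.

Definition smooth (f : Rn -> R^o) := forall s : seq 'I_n,
  continuous (iter_partial f s) /\
  forall x i, derivable (iter_partial f s) x (delta_mx 0 i).

Definition support (f : Rn -> R) : set Rn := closure [set x | f x != 0].

Definition test_function (Om : set Rn) (phi : Rn -> R) :=
  [/\ smooth phi, compact (support phi) & support phi `<=` Om].

Local Notation leb := (lebesgue_row R n).

(* The support of a function known up to null sets: the complement of the
   largest open set on which it vanishes a.e. *)
Definition ess_support (J : Rn -> R) : set Rn :=
  ~` \bigcup_(U in [set U : set Rn | open U /\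
       {ae leb, forall x, U x -> J x = 0}]) U.

Definition L2_on (Om : set Rn) (f : Rn -> R) :=
  measurable_fun Om f /\ (\int[leb]_(x in Om) ((f x) ^+ 2)%:E < +oo)%E.

End euclidean.

Definition euler_Gamma (R : realType) (a : R) : R :=
  \int[lebesgue_measure]_(t in `]0, +oo[%classic) (t `^ (a - 1) * expR (- t)).

(* c(n,s) = 4^s Gamma(n/2+s) / (pi^(n/2) |Gamma(-s)|), where for 0 < s < 1
   |Gamma(-s)| = Gamma(1-s) / s. *)
Definition frac_laplacian_const (R : realType) (n : nat) (s : R) : R :=
  4 `^ s * s * euler_Gamma (n%:R / 2 + s) /
  (pi `^ (n%:R / 2) * euler_Gamma (1 - s)).

(* Elements of the function spaces are everywhere-defined Borel representatives; all
   the (semi)norms and energies below are invariant under a.e. equality. *)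
Section spaces.
Context (R : realType) (n : nat).
Local Notation Rn := 'rV[R]_n.
Local Notation leb := (lebesgue_row R n).

Definition gagliardo (s : R) (D : set Rn) (v : Rn -> R) : \bar R :=
  (\int[leb]_(x in D) \int[leb]_(y in D)
     ((v x - v y) ^+ 2 / enorm (x - y) `^ (n%:R + 2 * s))%:E)%E.

Definition Hs_sqnorm (s : R) (v : Rn -> R) : \bar R :=
  (\int[leb]_x ((v x) ^+ 2)%:E + gagliardo s setT v)%E.

Definition Hs (s : R) : set (Rn -> R) :=
  [set v | measurable_fun setT v /\ (Hs_sqnorm s v < +oo)%E].

Definition Hs_tilde (s : R) (Om : set Rn) : set (Rn -> R) :=
  [set v | Hs s v /\ forall e : R, 0 < e -> exists2 phi,
     test_function Om phi & (Hs_sqnorm s (v \- phi)%R < (e ^+ 2)%:E)%E].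

Context (s1 s2 : R) (Om1 Om2 : set Rn).

Definition is_decomp (u : Rn -> R) (p : (Rn -> R) * (Rn -> R)) :=
  [/\ Hs_tilde s1 Om1 p.1, Hs_tilde s2 Om2 p.2 & u = p.1 \+ p.2].

Definition H_space : set (Rn -> R) := [set u | exists p, is_decomp u p].

(* The pair (u1, u2) with u = u1 + u2.  It is unique up to null sets, since each
   ui vanishes a.e. outside Omi and these are disjoint. *)
Definition parts (u : Rn -> R) : (Rn -> R) * (Rn -> R) :=
  xget (cst 0, cst 0) [set p | is_decomp u p].

Definition H_norm (u : Rn -> R) : R :=
  Num.sqrt (fine (gagliardo s1 setT (parts u).1
                  + gagliardo s2 setT (parts u).2)%E).

Definition energy (J : Rn -> R) (u : Rn -> R) : \bar R :=
  let u1 := (parts u).1 in let u2 := (parts u).2 in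
  let C1 := frac_laplacian_const n s1 / 2 in
  let C2 := frac_laplacian_const n s2 / 2 in
  ((C1 / 2)%:E * gagliardo s1 (~` Om2) u1
   + (C2 / 2)%:E * gagliardo s2 (~` Om1) u2
   + (2^-1)%:E * \int[leb]_(x in Om1) \int[leb]_(y in Om2)
       (J (x - y)%R * (u1 x - u2 y) ^+ 2)%:E)%E.

Definition total_energy (J f1 f2 : Rn -> R) (u : Rn -> R) : R^o :=
  fine (energy J u) - \int[leb]_(x in Om1) (f1 x * (parts u).1 x)
                    - \int[leb]_(x in Om2) (f2 x * (parts u).2 x).

Definition total_energy_finite (J f1 f2 : Rn -> R) (u : Rn -> R) :=
  [/\ energy J u \is a fin_num,
      leb.-integrable Om1 (fun x => (f1 x * (parts u).1 x)%:E) &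
      leb.-integrable Om2 (fun x => (f2 x * (parts u).2 x)%:E)].

End spaces.

Definition continuous_on (T : zmodType) (R : realType) (N : T -> R)
    (D : set T) (F : T -> R) :=
  forall u, D u -> forall e : R, 0 < e -> exists2 del : R, 0 < del &
    forall v, D v -> N (v - u) < del -> `|F v - F u| < e.

(* Main.v *)
Require Import Defs.
From HB Require Import structures.
From mathcomp Require Import all_boot all_order all_algebra.
From mathcomp Require Import all_classical all_reals all_analysis.
From mathcomp Require Import measurable_realfun.
From mathcomp Require Import ring lra.
Import Order.TTheory GRing.Theory Num.Theory.
Import numFieldNormedType.Exports.
Local Open Scope classical_set_scope.
Local Open Scope ring_scope.

(** The three double integrals of the energy have the same shape
    [qform K A B g h], the integral over [x] in [A] and [y] in [B] of
    [K (x, y) * (g x - h y) ^+ 2] with [K >= 0].  Such an expression depends on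
    [(g, h)] only through squares of linear quantities, so every scalar
    inequality [(al * s + be * t) ^+ 2 <= a * s ^+ 2 + b * t ^+ 2] turns into
    the same inequality between forms ([qform_comb], then [quad_energy_comb]).
    Two instances give the theorem.

    Convexity is the instance [al = a = t], [be = b = 1 - t], together with the
    linearity of the two load terms.

    For continuity, put [w = v - u].  The instance
    [(s + t) ^+ 2 <= (1 + eta) * s ^+ 2 + (1 + eta^-1) * t ^+ 2], applied both
    to [v = u + w] and to [u = v - w], shows that the energies of [u] and [v]
    are close as soon as the energy of [w] is small ([continuity_modulus]).  It
    remains to bound the energy and the squared L2 norms of [w] by the squared
    norm of [w] in [H], which is a sum of Gagliardo seminorms only.  The
    nonlocal seminorms in the energy are restrictions of those.  The L2 norms
    are controlled by the fractional Poincare inequality ([poincare]): on a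
    cube far away from the bounded domain the function vanishes, so the
    seminorm already sees the differences between the values of the function
    and zero, with a weight bounded below.  The interaction term is at most
    [2 * |J|_1] times the squared L2 norms ([interaction_le]), by translation
    and reflection invariance of Lebesgue measure on row vectors.

    The components of an element of [H] are chosen representatives, hence they
    are additive in [u] only up to null sets ([parts_lincomb]).  This holds
    because an L2 limit of test functions supported in [Om] vanishes almost
    everywhere outside [Om] ([Hs_tilde_ae0]) and the domains are disjoint; the
    comparison lemmas are therefore stated under almost everywhere
    equalities. *)

Set Implicit Arguments.
Unset Strict Implicit.

(** * Borel structure and invariance of Lebesgue measure on row vectors *)

Section borel_rows.
Context (R : realType).

Lemma measurable_fun_rV d (T : measurableType d) n (f : T -> 'rV[R]_n) :
  (forall i, measurable_fun setT (fun t => f t 0 i : measurableTypeR R)) ->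
  measurable_fun setT f.
Proof.
move=> mf; apply: (@measurability _ _ _ _ setT f
  (\big[setU/set0]_(i < n)
    preimage_set_system setT (@rV_coord R n i) measurable)) => //.
case: n f mf => [|n] f mf; first by move=> _ [A + <-]; rewrite big_ord0.
move=> _ [A + <-]; rewrite -bigcup_mkord_ord => -[k kn [B mB <-]].
rewrite !setTI -comp_preimage -[X in measurable X]setTI.
exact: mf.
Qed.

(** The sigma-algebra is generated by the coordinates whereas open sets come
    from the product topology: an open set is the union of the boxes with
    rational endpoints that it contains, and there are countably many. *)
Lemma open_measurable_rV n (U : set 'rV[R]_n) : open U -> measurable U.
Proof.
move=> oU.
pose box (q : 'rV[rat]_n * 'rV[rat]_n) : set 'rV[R]_n :=
  \bigcap_(i in [set: 'I_n])
    (@rV_coord R n i @^-1` `](ratr (q.1 0 i)), (ratr (q.2 0 i))[%classic).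
have mbox q : measurable (box q).
  apply: fin_bigcap_measurable => // i _.
  rewrite -[X in measurable X]setTI; apply: measurable_rV_coord => //.
pose F q := if `[< box q `<=` U >] then box q else set0.
suff -> : U = \bigcup_q F q.
  apply: countable_bigcupT_measurable => // q.
  by rewrite /F; case: ifP.
apply/seteqP; split => [x Ux|x [q _]]; last first.
  by rewrite /F; case: asboolP => // /[apply].
have [P nP PU] : nbhs x U by exact: open_nbhs_nbhs.
have H i : exists q : rat * rat, ratr q.1 < x 0 i < ratr q.2 /\
    `](ratr q.1 : R), (ratr q.2)[ `<=` P 0 i.
  have /nbhs_ballP[e /= e0 eP] := nP 0 i.
  have /rat_in_itvoo[q1] : x 0 i - e < x 0 i by rewrite ltrBlDr ltrDl.
  rewrite in_itv/= => /andP[q11 q12].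
  have /rat_in_itvoo[q2] : x 0 i < x 0 i + e by rewrite ltrDl.
  rewrite in_itv/= => /andP[q21 q22].
  exists (q1, q2); split; first by rewrite /= q12 q21.
  move=> y /=; rewrite in_itv/= => /andP[y1 y2]; apply: eP.
  by rewrite /ball/= ltr_distlC (lt_trans q11 y1) (lt_trans y2 q22).
have {}H i := cid (H i).
pose q : 'rV[rat]_n * 'rV[rat]_n :=
  (\row_i (projT1 (H i)).1, \row_i (projT1 (H i)).2).
exists q => //; rewrite /F.
have bU : box q `<=` U.
  move=> y by_; apply: PU => i j; rewrite (ord1 i).
  have := by_ j I; rewrite /= !mxE.
  by case: (H j) => /= -[a b] /= [_]; apply.
rewrite asboolT// => i _ /=; rewrite !mxE in_itv/=.
by case: (H i) => /= -[a b] /= [].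
Qed.

Lemma measurable_rV_sub d (T : measurableType d) n (f g : T -> 'rV[R]_n) :
  measurable_fun setT f -> measurable_fun setT g ->
  measurable_fun setT (fun t => f t - g t).
Proof.
move=> mf mg; apply: measurable_fun_rV => i.
rewrite (_ : (fun _ => _) = (@rV_coord R n i \o f) \- (@rV_coord R n i \o g)).
  by apply: measurable_funB; apply: measurableT_comp => //;
    exact: measurable_rV_coord.
by apply/funext => t; rewrite /rV_coord /= !mxE.
Qed.

Lemma continuous_measurable_rV n (f : 'rV[R]_n -> R^o) :
  continuous f -> measurable_fun setT (f : 'rV[R]_n -> R).
Proof.
move=> cf.
apply: (measurability _ (RGenOpens.measurableE R)) => _ [_ [a [b ->]] <-].
rewrite setTI; apply: open_measurable_rV.
by apply: open_comp; [move=> x _; exact: cf | exact: interval_open].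
Qed.

Lemma measurable_enorm n : measurable_fun setT (@enorm R n).
Proof.
rewrite /enorm.
apply: measurableT_comp.
  apply: continuous_measurable_fun; exact: sqrt_continuous.
apply: measurable_sum => i.
by apply: measurable_funX; exact: measurable_rV_coord.
Qed.

(* invariance *)
Lemma lebesgue_measure_reflect (c : R) (A : set (measurableTypeR R)) :
  measurable A ->
  lebesgue_measure ((fun a : measurableTypeR R => c - a) @^-1` A) =
  lebesgue_measure A.
Proof.
move=> mA; have mc : measurable_fun setT
    (fun a : measurableTypeR R => c - a : measurableTypeR R).
  by apply: measurable_funB.
rewrite -[LHS]/(pushforward lebesgue_measure
  (fun a : measurableTypeR R => c - a : measurableTypeR R) A).
apply/esym/lebesgue_measure_unique => //= _ [[a b]] _ <-.
rewrite /pushforward.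
rewrite (_ : _ @^-1` _ = `[c - b, c - a[%classic); last first.
  apply/seteqP; split => x /=; rewrite !in_itv/= => /andP[h1 h2];
  apply/andP; split; lra.
rewrite !lebesgue_measure_itv/= !lte_fin.
rewrite ltrD2l ltrN2; case: ifP => // _.
by rewrite -!EFinD; congr EFin; lra.
Qed.

Lemma measurable_reflect n (c : 'rV[R]_n) :
  measurable_fun setT (fun x : 'rV[R]_n => c - x).
Proof. by apply: measurable_rV_sub => //; exact: measurable_id. Qed.

(** Reflections suffice for all later uses, and composing two of them gives
    the translations.  On the product that defines the measure in one more
    dimension, a reflection acts on each factor separately, so the image
    measure agrees with the product measure on rectangles. *)
Lemma lebesgue_row_reflect n (c : 'rV[R]_n) (A : set 'rV[R]_n) :
  measurable A ->
  lebesgue_row R n ((fun x => c - x) @^-1` A) = lebesgue_row R n A.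
Proof.
elim: n c A => [|n IH] c A mA.
  rewrite (_ : _ @^-1` A = A)//; apply/funext => x.
  by rewrite /preimage/mkset (_ : c - x = x)//; apply/rowP => -[].
rewrite /= /lebesgue_row_succ /pushforward.
pose c0 := c 0 ord0.
pose ct : 'rV[R]_n := \row_j c 0 (lift ord0 j).
pose g (p : measurableTypeR R * 'rV[R]_n) : measurableTypeR R * 'rV[R]_n :=
  (c0 - p.1, ct - p.2).
have mg : measurable_fun setT g.
  apply/measurable_fun_pairP; split.
    by apply: measurable_funB => //; exact: measurable_fst.
  by apply: measurable_rV_sub => //; exact: measurable_snd.
have gE : (fun x => c - x) \o @row_cons R n = @row_cons R n \o g.
  apply/funext => p; apply/rowP => i; rewrite /= !mxE.
  by case: unliftP => [j ->|->] //; rewrite !mxE.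
rewrite -comp_preimage gE comp_preimage.
have mA' : measurable (@row_cons R n @^-1` A).
  by rewrite -[X in measurable X]setTI; exact: measurable_row_cons.
rewrite -[LHS]/(pushforward (lebesgue_measure \x lebesgue_row R n)%E g _).
apply/esym/product_measure_unique => //=.
move=> B C mB mC; rewrite /pushforward.
rewrite (_ : _ @^-1` _ = ((fun a : measurableTypeR R => c0 - a) @^-1` B)
    `*` ((fun x => ct - x) @^-1` C)) //.
have mB' : measurable ((fun a : measurableTypeR R => c0 - a) @^-1` B).
  rewrite -[X in measurable X]setTI.
  by apply: measurable_funB => //.
have mC' : measurable ((fun x => ct - x) @^-1` C).
  by rewrite -[X in measurable X]setTI; exact: measurable_reflect.
rewrite [LHS]product_measure1E// IH//; congr (_ * _)%E.
exact: lebesgue_measure_reflect.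
Qed.

Lemma ae_reflect n (c : 'rV[R]_n) (P : set 'rV[R]_n) :
  {ae lebesgue_row R n, forall x, P x} ->
  {ae lebesgue_row R n, forall x, P (c - x)}.
Proof.
move=> [N [mN N0 PN]]; exists ((fun x => c - x) @^-1` N); split.
- by rewrite -[X in measurable X]setTI; exact: measurable_reflect.
- by rewrite lebesgue_row_reflect.
- by move=> x; exact: PN.
Qed.

Lemma ge0_integral_reflect n (c : 'rV[R]_n) (f : 'rV[R]_n -> \bar R) :
  measurable_fun setT f -> (forall x, 0 <= f x)%E ->
  (\int[lebesgue_row R n]_x f (c - x)%R = \int[lebesgue_row R n]_x f x)%E.
Proof.
move=> mf f0.
have := @ge0_integral_pushforward _ _ _ _ R _ (measurable_reflect c)
  (lebesgue_row R n) setT f measurableT mf (fun x _ => f0 x).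
rewrite preimage_setT => <-.
apply: eq_measure_integral => [|mR A mA _]; first exact: measurable_reflect.
exact: (lebesgue_row_reflect c mA).
Qed.

Lemma measurable_cube n (a b : R) :
  measurable [set x : 'rV[R]_n | forall i, x 0 i \in `[a, b]].
Proof.
rewrite (_ : mkset _ = \bigcap_(i in [set: 'I_n])
  (@rV_coord R n i @^-1` `[a, b]%classic)); last first.
  by apply/seteqP; split => [x h i _|x h i]; [exact: h|exact: (h i I)].
apply: fin_bigcap_measurable => // i _.
rewrite -[X in measurable X]setTI; exact: measurable_rV_coord.
Qed.

(** Normalised to measure 1 so that integrating an indicator over the cube
    contributes the factor 1. *)
Lemma lebesgue_row_cube n (a : R) :
  lebesgue_row R n [set x | forall i, x 0 i \in `[a, a + 1]] = 1%E.
Proof.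
elim: n => [|n IH].
  by rewrite /= diracE (_ : _ \in _) // inE => -[].
rewrite /= /lebesgue_row_succ /pushforward.
rewrite (_ : _ @^-1` _ = (`[a, a + 1]%classic : set (measurableTypeR R)) `*`
   [set x : 'rV[R]_n | forall i, x 0 i \in `[a, a + 1]]); last first.
  apply/seteqP; split => -[x v] /=.
    move=> h; split; first by have := h ord0; rewrite mxE unlift_none.
    by move=> i; have := h (lift ord0 i); rewrite mxE liftK.
  move=> [h1 h2] i; rewrite mxE; case: unliftP => [j _|_]//=.
rewrite product_measure1E//; last exact: measurable_cube.
rewrite IH mule1 -[LHS]/(lebesgue_measure `[a, a + 1]%classic).
by rewrite lebesgue_measure_itv/= lte_fin ltrDl ltr01 -EFinD addrAC subrr add0r.
Qed.

End borel_rows.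

(** * Comparison of iterated integrals and of quadratic forms *)

Lemma ae_ge0_le_integral_lincomb d (T : measurableType d) (R : realType)
    (mu : {measure set T -> \bar R}) (D : set T) (f g h : T -> \bar R)
    (a b : R) :
  measurable D -> measurable_fun D f -> measurable_fun D g ->
  measurable_fun D h ->
  (forall x, D x -> 0 <= f x)%E -> (forall x, D x -> 0 <= g x)%E ->
  (forall x, D x -> 0 <= h x)%E -> 0 <= a -> 0 <= b ->
  {ae mu, forall x, D x -> f x <= a%:E * g x + b%:E * h x}%E ->
  (\int[mu]_(x in D) f x <=
   a%:E * \int[mu]_(x in D) g x + b%:E * \int[mu]_(x in D) h x)%E.
Proof.
move=> mD mf mg mh f0 g0 h0 a0 b0 fgh.
have ag0 x : D x -> (0 <= a%:E * g x)%E by move=> Dx; rewrite mule_ge0// g0.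
have bh0 x : D x -> (0 <= b%:E * h x)%E by move=> Dx; rewrite mule_ge0// h0.
have mag : measurable_fun D (fun x => a%:E * g x)%E by exact: measurable_funeM.
have mbh : measurable_fun D (fun x => b%:E * h x)%E by exact: measurable_funeM.
rewrite -(ge0_integralZl mu mD mg g0)// -(ge0_integralZl mu mD mh h0)//.
rewrite -(ge0_integralD mu mD ag0 mag bh0 mbh).
apply: ae_ge0_le_integral => //; last exact: emeasurable_funD.
by move=> x Dx; rewrite adde_ge0 ?ag0 ?bh0.
Qed.

Lemma EFin_mule_ge0 (R : realType) (c : R) (x : \bar R) :
  0 <= c -> (0 <= x)%E -> (0 <= c%:E * x)%E.
Proof. by move=> c0; apply: mule_ge0; rewrite lee_fin. Qed.

Lemma lee_lincombD (R : realType) (a b : R) (x x1 x2 y y1 y2 : \bar R) :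
  (0 <= x1)%E -> (0 <= x2)%E -> (0 <= y1)%E -> (0 <= y2)%E ->
  (x <= a%:E * x1 + b%:E * x2)%E -> (y <= a%:E * y1 + b%:E * y2)%E ->
  (x + y <= a%:E * (x1 + y1) + b%:E * (x2 + y2))%E.
Proof.
move=> x10 x20 y10 y20 xle yle.
by rewrite !ge0_muleDr// addeACA leeD.
Qed.

Lemma lee_lincombM (R : realType) (a b c : R) (x x1 x2 : \bar R) :
  0 <= a -> 0 <= b -> 0 <= c -> (0 <= x1)%E -> (0 <= x2)%E ->
  (x <= a%:E * x1 + b%:E * x2)%E ->
  (c%:E * x <= a%:E * (c%:E * x1) + b%:E * (c%:E * x2))%E.
Proof.
move=> a0 b0 c0 x10 x20 xle.
rewrite !(muleCA _ c%:E) -ge0_muleDr ?mule_ge0 ?lee_fin//.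
by apply: lee_wpmul2l; rewrite ?lee_fin.
Qed.

Section iterated_integrals.
Local Open Scope ereal_scope.
Context d1 d2 (T1 : measurableType d1) (T2 : measurableType d2) (R : realType).
Context (m1 : {sigma_finite_measure set T1 -> \bar R})
        (m2 : {sigma_finite_measure set T2 -> \bar R}).
Implicit Types (A : set T1) (B : set T2) (F G H : T1 * T2 -> R).

Lemma measurable_section F x : measurable_fun setT F ->
  measurable_fun setT (fun y => (F (x, y))%:E).
Proof.
move=> mF; apply/measurable_EFinP.
by apply: (measurableT_comp mF); exact: pair1_measurable.
Qed.

Lemma measurable_partial_integral A B F : measurable B ->
  measurable_fun setT F -> (forall p, 0 <= F p)%R ->
  measurable_fun A (fun x => \int[m2]_(y in B) (F (x, y))%:E).
Proof.
move=> mB mF F0; apply: measurable_funTS.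
rewrite (_ : (fun _ => _) = fubini_F m2 (fun p => (F p * \1_B p.2)%:E)).
  apply: measurable_fun_fubini_tonelli_F => [|p].
    apply/measurable_EFinP; apply: measurable_funM => //.
    by apply: measurableT_comp; [exact: measurable_indic | exact: measurable_snd].
  by rewrite lee_fin mulr_ge0// indicE.
apply/funext => x; rewrite /fubini_F [LHS]integral_mkcond.
apply: eq_integral => y _; rewrite patchE/= indicE.
by case: ifPn => _; rewrite ?mulr1 ?mulr0.
Qed.

Lemma partial_integral_ge0 B F x : (forall p, 0 <= F p)%R ->
  0 <= \int[m2]_(y in B) (F (x, y))%:E.
Proof. by move=> F0; apply: integral_ge0 => y _; rewrite lee_fin. Qed.

(** The workhorse: all comparisons between energies are instances.  The
    hypothesis is iterated rather than almost everywhere for the product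
    measure, which is the form in which it follows from almost everywhere
    properties of each variable. *)
Lemma le_iterated_integral A B F G H (a b : R) :
  measurable A -> measurable B ->
  measurable_fun setT F -> measurable_fun setT G -> measurable_fun setT H ->
  (forall p, 0 <= F p)%R -> (forall p, 0 <= G p)%R -> (forall p, 0 <= H p)%R ->
  (0 <= a)%R -> (0 <= b)%R ->
  {ae m1, forall x, {ae m2, forall y,
    (F (x, y) <= a * G (x, y) + b * H (x, y))%R}} ->
  \int[m1]_(x in A) \int[m2]_(y in B) (F (x, y))%:E <=
  a%:E * \int[m1]_(x in A) \int[m2]_(y in B) (G (x, y))%:E +
  b%:E * \int[m1]_(x in A) \int[m2]_(y in B) (H (x, y))%:E.
Proof.
move=> mA mB mF mG mH F0 G0 H0 a0 b0 FGH.
have mS (K : T1 * T2 -> R) x : measurable_fun setT K ->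
    measurable_fun B (fun y => (K (x, y))%:E : \bar R).
  by move=> mK; exact/measurable_funTS/measurable_section.
apply: ae_ge0_le_integral_lincomb => //; try exact: measurable_partial_integral;
  try (by move=> x _; exact: partial_integral_ge0).
apply: filterS FGH => x FGH _.
apply: ae_ge0_le_integral_lincomb => //; try exact: mS;
  try (by move=> y _; rewrite lee_fin).
by apply: filterS FGH => y FGH _; rewrite -!EFinM -EFinD lee_fin.
Qed.

Lemma iterated_integral_subset A A' B B' F :
  measurable A -> measurable A' -> measurable B -> measurable B' ->
  measurable_fun setT F -> (forall p, 0 <= F p)%R ->
  A `<=` A' -> B `<=` B' ->
  \int[m1]_(x in A) \int[m2]_(y in B) (F (x, y))%:E <=
  \int[m1]_(x in A') \int[m2]_(y in B') (F (x, y))%:E.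
Proof.
move=> mA mA' mB mB' mF F0 AA' BB'.
apply: (@le_trans _ _ (\int[m1]_(x in A) \int[m2]_(y in B') (F (x, y))%:E)).
  apply: ge0_le_integral => //.
  - by move=> x _; exact: partial_integral_ge0.
  - exact: measurable_partial_integral.
  - exact: measurable_partial_integral.
  - move=> x _; apply: ge0_subset_integral => //.
    by apply: measurable_funTS; exact: measurable_section.
    by move=> y _; rewrite lee_fin.
apply: ge0_subset_integral => //.
  exact: measurable_partial_integral.
by move=> x _; exact: partial_integral_ge0.
Qed.

End iterated_integrals.

Section quadratic_forms.
Context d (T : measurableType d) (R : realType).
Context (m : {sigma_finite_measure set T -> \bar R}).
Implicit Types (A B : set T) (K : T * T -> R) (g h : T -> R).

Definition qform K A B g h : \bar R :=
  (\int[m]_(x in A) \int[m]_(y in B) (K (x, y) * (g x - h y) ^+ 2)%:E)%E.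

Lemma measurable_qform_integrand K g h : measurable_fun setT K ->
  measurable_fun setT g -> measurable_fun setT h ->
  measurable_fun setT (fun p : T * T => K p * (g p.1 - h p.2) ^+ 2).
Proof.
move=> mK mg mh; apply: measurable_funM => //; apply: measurable_funX.
by apply: measurable_funB; apply: measurableT_comp.
Qed.

Lemma qform_ge0 K A B g h : (forall p, 0 <= K p) -> (0 <= qform K A B g h)%E.
Proof.
move=> K0; apply: integral_ge0 => x _; apply: integral_ge0 => y _.
by rewrite lee_fin mulr_ge0// sqr_ge0.
Qed.

(** The difference [g x - h y] is the same combination of the differences for
    [(g1, h1)] and [(g2, h2)], so a scalar inequality between squares can be
    integrated against the kernel.  With [al = a = 1] and [be = b = 0] it
    shows that the form is insensitive to null sets. *)
Lemma qform_comb K A B g h g1 h1 g2 h2 (al be a b : R) :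
  measurable A -> measurable B -> measurable_fun setT K ->
  (forall p, 0 <= K p) ->
  measurable_fun setT g -> measurable_fun setT h ->
  measurable_fun setT g1 -> measurable_fun setT h1 ->
  measurable_fun setT g2 -> measurable_fun setT h2 ->
  0 <= a -> 0 <= b ->
  (forall s t, (al * s + be * t) ^+ 2 <= a * s ^+ 2 + b * t ^+ 2) ->
  {ae m, forall x, g x = al * g1 x + be * g2 x} ->
  {ae m, forall x, h x = al * h1 x + be * h2 x} ->
  (qform K A B g h <= a%:E * qform K A B g1 h1 + b%:E * qform K A B g2 h2)%E.
Proof.
move=> mA mB mK K0 mg mh mg1 mh1 mg2 mh2 a0 b0 ab gE hE.
pose I (u v : T -> R) (p : T * T) := K p * (u p.1 - v p.2) ^+ 2.
have I0 u v p : 0 <= I u v p by rewrite mulr_ge0// sqr_ge0.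
apply: (@le_iterated_integral _ _ _ _ R m m A B (I g h) (I g1 h1) (I g2 h2))
  => //; try exact: measurable_qform_integrand.
apply: filterS gE => x gE; apply: filterS hE => y hE.
rewrite /I/= gE hE (_ : _ - _ = al * (g1 x - h1 y) + be * (g2 x - h2 y)).
  apply: (le_trans (ler_wpM2l (K0 _) (ab _ _))).
  by rewrite mulrDr !(mulrCA (K _)).
by ring.
Qed.

Lemma l2_comb A g g1 g2 (al be a b : R) :
  measurable A ->
  measurable_fun setT g -> measurable_fun setT g1 -> measurable_fun setT g2 ->
  0 <= a -> 0 <= b ->
  (forall s t, (al * s + be * t) ^+ 2 <= a * s ^+ 2 + b * t ^+ 2) ->
  {ae m, forall x, g x = al * g1 x + be * g2 x} ->
  (\int[m]_(x in A) (g x ^+ 2)%:E <= a%:E * \int[m]_(x in A) (g1 x ^+ 2)%:E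
     + b%:E * \int[m]_(x in A) (g2 x ^+ 2)%:E)%E.
Proof.
move=> mA mg mg1 mg2 a0 b0 ab gE.
have msq (u : T -> R) : measurable_fun setT u ->
    measurable_fun A (fun x => (u x ^+ 2)%:E).
  by move=> mu; apply/measurable_EFinP; apply: measurable_funX;
    exact: measurable_funTS.
have sq0 (u : T -> R) x : (0 <= (u x ^+ 2)%:E)%E by rewrite lee_fin sqr_ge0.
apply: ae_ge0_le_integral_lincomb => //; try exact: msq.
apply: filterS gE => x gE _.
by rewrite -!EFinM -EFinD lee_fin gE.
Qed.

End quadratic_forms.

(** * Linear structure of the fractional spaces *)

Section fractional_spaces.
Context (R : realType) (n : nat).
Local Notation Rn := 'rV[R]_n.
Local Notation leb := (lebesgue_row R n).

(** The value on the diagonal is 0 for a nonzero exponent, since 0 raised to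
    such an exponent and the inverse of 0 are both 0. *)
Definition frac_kernel (s : R) (p : Rn * Rn) : R :=
  (enorm (p.1 - p.2) `^ (n%:R + 2 * s))^-1.

Lemma frac_kernel_ge0 s p : 0 <= frac_kernel s p.
Proof. by rewrite /frac_kernel invr_ge0 powR_ge0. Qed.

Lemma measurable_frac_kernel s : measurable_fun setT (frac_kernel s).
Proof.
rewrite (_ : frac_kernel s = (fun r => r `^ (- (n%:R + 2 * s)))
    \o (@enorm R n) \o (fun p : Rn * Rn => p.1 - p.2)).
  apply: measurableT_comp.
    by apply: measurableT_comp; [exact: measurable_powR|exact: measurable_enorm].
  by apply: measurable_rV_sub; [exact: measurable_fst|exact: measurable_snd].
by apply/funext => p; rewrite /frac_kernel/= powRN.
Qed.

Lemma gagliardoE s D v : gagliardo s D v = qform leb (frac_kernel s) D D v v.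
Proof.
apply: eq_integral => x _; apply: eq_integral => y _.
by rewrite mulrC.
Qed.

Lemma gagliardo_ge0 s D (v : Rn -> R) : (0 <= gagliardo s D v)%E.
Proof. by rewrite gagliardoE; apply: qform_ge0 => p; exact: frac_kernel_ge0. Qed.

Lemma gagliardo_subset s D (v : Rn -> R) : measurable D ->
  measurable_fun setT v -> (gagliardo s D v <= gagliardo s setT v)%E.
Proof.
move=> mD mv; rewrite !gagliardoE.
apply: (@iterated_integral_subset _ _ _ _ R leb leb D setT D setT
  (fun p => frac_kernel s p * (v p.1 - v p.2) ^+ 2)) => //.
  by apply: measurable_qform_integrand => //; exact: measurable_frac_kernel.
by move=> p; rewrite mulr_ge0 ?frac_kernel_ge0 ?sqr_ge0.
Qed.

Lemma sqr_lincomb_le (al be s t : R) :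
  (al * s + be * t) ^+ 2 <= 2 * al ^+ 2 * s ^+ 2 + 2 * be ^+ 2 * t ^+ 2.
Proof.
have := sqr_ge0 (al * s - be * t); nra.
Qed.

(** Stands in for the triangle inequality of the norm: with [sqr_lincomb_le]
    it bounds the squared norm of a combination without square roots. *)
Lemma Hs_sqnorm_comb s (g g1 g2 : Rn -> R) (al be a b : R) :
  measurable_fun setT g -> measurable_fun setT g1 -> measurable_fun setT g2 ->
  0 <= a -> 0 <= b ->
  (forall s t, (al * s + be * t) ^+ 2 <= a * s ^+ 2 + b * t ^+ 2) ->
  {ae leb, forall x, g x = al * g1 x + be * g2 x} ->
  (Hs_sqnorm s g <= a%:E * Hs_sqnorm s g1 + b%:E * Hs_sqnorm s g2)%E.
Proof.
move=> mg mg1 mg2 a0 b0 ab gE; rewrite /Hs_sqnorm !gagliardoE.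
have mK := measurable_frac_kernel s.
have K0 := frac_kernel_ge0 s.
have sq0 (v : Rn -> R) : (0 <= \int[leb]_x (v x ^+ 2)%:E)%E.
  by apply: integral_ge0 => x _; rewrite lee_fin sqr_ge0.
have q0 (v : Rn -> R) := qform_ge0 leb setT setT v v K0.
apply: lee_lincombD (sq0 g1) (sq0 g2) (q0 g1) (q0 g2) _ _.
  exact: (@l2_comb _ _ _ leb setT g g1 g2 al be a b).
exact: (@qform_comb _ _ _ leb (frac_kernel s) setT setT
  g g g1 g1 g2 g2 al be a b).
Qed.

Lemma iter_partial_lincomb (f g : Rn -> R^o) (al be : R) (s : seq 'I_n) :
  smooth f -> smooth g ->
  iter_partial (fun x => al * f x + be * g x : R^o) s =
  (fun x => al * iter_partial f s x + be * iter_partial g s x).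
Proof.
move=> sf sg; elim: s => // i s IH; rewrite /= IH; apply/funext => x.
have [_ df] := sf s; have [_ dg] := sg s.
rewrite -[X in derive X]/(al *: iter_partial f s + be *: iter_partial g s).
rewrite deriveD; [|exact: derivableZ|exact: derivableZ].
by rewrite !deriveZ.
Qed.

Lemma smooth_lincomb (f g : Rn -> R^o) (al be : R) :
  smooth f -> smooth g -> smooth (fun x => al * f x + be * g x : R^o).
Proof.
move=> sf sg s; rewrite iter_partial_lincomb//.
rewrite -[fun x => _]/(al *: iter_partial f s + be *: iter_partial g s).
have [cf df] := sf s; have [cg dg] := sg s; split.
  by move=> x; apply: continuousD; apply: continuousZl_tmp; [exact: cf|exact: cg].
by move=> x i; apply: derivableD; exact: derivableZ.
Qed.

Lemma test_function_lincomb (Om : set Rn) (f g : Rn -> R) (al be : R) :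
  test_function Om f -> test_function Om g ->
  test_function Om (fun x => al * f x + be * g x).
Proof.
move=> [sf cf fOm] [sg cg gOm].
have sub : Defs.support (fun x => al * f x + be * g x) `<=`
    Defs.support f `|` Defs.support g.
  rewrite /Defs.support -closureU; apply: closure_subset => x /=.
  have [->|fx _] := eqVneq (f x) 0; last by left.
  have [->|gx _] := eqVneq (g x) 0; last by right.
  by rewrite !mulr0 addr0 eqxx.
split; first exact: smooth_lincomb.
  by apply: (subclosed_compact _ (compactU cf cg) sub); exact: closed_closure.
by move=> x /sub[/fOm|/gOm].
Qed.

Lemma test_function_measurable (Om : set Rn) f :
  test_function Om f -> measurable_fun setT f.
Proof.
by move=> [sf _ _]; have [cf _] := sf [::]; exact: continuous_measurable_rV.
Qed.

Lemma Hs_tilde_measurable s Om (v : Rn -> R) :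
  Hs_tilde s Om v -> measurable_fun setT v.
Proof. by move=> [[]]. Qed.

Lemma measurable_lincomb (g1 g2 : Rn -> R) al be :
  measurable_fun setT g1 -> measurable_fun setT g2 ->
  measurable_fun setT (fun x => al * g1 x + be * g2 x).
Proof.
move=> m1 m2; apply: measurable_funD; exact: measurable_funM.
Qed.

Lemma Hs_tilde_lincomb s Om (u v : Rn -> R) al be :
  Hs_tilde s Om u -> Hs_tilde s Om v ->
  Hs_tilde s Om (fun x => al * u x + be * v x).
Proof.
move=> [[mu uoo] hu] [[mv voo] hv].
have ab0 (c : R) : 0 <= 2 * c ^+ 2 by rewrite mulr_ge0 ?sqr_ge0.
split; first split.
- exact: measurable_lincomb.
- apply: le_lt_trans.
    apply: (Hs_sqnorm_comb (al := al) (be := be) s _ mu mv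
      (ab0 al) (ab0 be) (sqr_lincomb_le al be)).
      exact: measurable_lincomb.
    exact: aeW.
  have w0 (c : R) : (0 <= (2 * c ^+ 2)%:E)%E by rewrite lee_fin.
  exact: (lte_add_pinfty (lte_mul_pinfty (w0 al) isT uoo)
    (lte_mul_pinfty (w0 be) isT voo)).
- move=> e e0.
  (* Approximations within [e / sqrt M] of both functions combine to one
     within [e], [M] exceeding the sum of the weights. *)
  pose M := 2 * al ^+ 2 + 2 * be ^+ 2 + 1.
  have M0 : 0 < M by rewrite ltr_wpDl// addr_ge0.
  have d0 : 0 < e / Num.sqrt M by rewrite divr_gt0// sqrtr_gt0.
  have [f tf fu] := hu _ d0; have [g tg gv] := hv _ d0.
  exists (fun x => al * f x + be * g x); first exact: test_function_lincomb.
  have mf := test_function_measurable tf.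
  have mg := test_function_measurable tg.
  apply: le_lt_trans.
    apply: (Hs_sqnorm_comb (al := al) (be := be) (g1 := u \- f) (g2 := v \- g)
      s _ _ _ (ab0 al) (ab0 be) (sqr_lincomb_le al be)).
    + by apply: measurable_funB; exact: measurable_lincomb.
    + exact: measurable_funB.
    + exact: measurable_funB.
    + by apply: aeW => x /=; ring.
  move: fu gv; rewrite exprMn exprVn sqr_sqrtr ?(ltW M0)// => fu gv.
  apply: (@le_lt_trans _ _ ((2 * al ^+ 2)%:E * (e ^+ 2 / M)%:E +
                            (2 * be ^+ 2)%:E * (e ^+ 2 / M)%:E)%E).
    have w0 (c : R) : (0 <= (2 * c ^+ 2)%:E)%E by rewrite lee_fin.
    exact: (leeD (lee_wpmul2l (w0 al) (ltW fu)) (lee_wpmul2l (w0 be) (ltW gv))).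
  rewrite -!EFinM -EFinD lte_fin -mulrDl mulrCA gtr_pMr ?exprn_gt0//.
  by rewrite ltr_pdivrMr// mul1r /M ltrDl.
Qed.

(** Test functions vanish outside [Om], so the L2 norm of [v] outside [Om] is
    at most the distance from [v] to any of them, hence is zero. *)
Lemma Hs_tilde_ae0 s Om (v : Rn -> R) : measurable Om ->
  Hs_tilde s Om v -> {ae leb, forall x, ~ Om x -> v x = 0}.
Proof.
move=> mOm [[mv _] hv].
have mC : measurable (~` Om) by exact: measurableC.
have mv2 : measurable_fun (~` Om) (fun x => (v x ^+ 2)%:E).
  by apply/measurable_EFinP; apply: measurable_funX; exact: measurable_funTS.
have h0 : (\int[leb]_(x in ~` Om) `|(v x ^+ 2)%:E| = 0)%E.
  apply/eqP; rewrite eq_le; apply/andP; split; last exact: integral_ge0.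
  apply/lee_addgt0Pr => e e0; rewrite add0e.
  have se0 : 0 < Num.sqrt e by rewrite sqrtr_gt0.
  have [f tf fv] := hv _ se0; rewrite sqr_sqrtr ?ltW// in fv.
  apply: (le_trans _ (ltW fv)).
  have mf := test_function_measurable tf.
  have mvf : measurable_fun setT (fun x => (((v \- f) x) ^+ 2)%:E).
    by apply/measurable_EFinP; apply: measurable_funX; exact: measurable_funB.
  apply: (@le_trans _ _ (\int[leb]_x (((v \- f) x) ^+ 2)%:E)%E); last first.
    by rewrite /Hs_sqnorm leeDl// gagliardo_ge0.
  rewrite (eq_integral (fun x => (((v \- f) x) ^+ 2)%:E)); last first.
    move=> x /set_mem Omx; rewrite gee0_abs ?lee_fin ?sqr_ge0//=.
    suff -> : f x = 0 by rewrite subr0.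
    have [_ _ sf] := tf; apply/eqP/negPn/negP => fx; apply: Omx; apply: sf.
    exact: subset_closure.
  apply: ge0_subset_integral => //.
  by move=> x _; rewrite lee_fin sqr_ge0.
have /(_ h0) := (ae_eq_integral_abs leb mC mv2).1.
apply: filterS => x h Omx; have := h Omx.
by move=> -[] /eqP; rewrite sqrf_eq0 => /eqP.
Qed.

End fractional_spaces.

(** * A fractional Poincare inequality *)

Section poincare.
Context (R : realType) (n : nat).
Local Notation Rn := 'rV[R]_n.
Local Notation leb := (lebesgue_row R n).

Lemma coord_le_norm (x : Rn) i : `|x 0 i| <= `|x|.
Proof.
rewrite [leRHS]mx_normrE.
exact: (le_bigmax _ (fun k : 'I_1 * 'I_n => `|x k.1 k.2|) (0, i)).
Qed.

Lemma sq_le_fin (I : finType) (f : I -> R) i : f i ^+ 2 <= \sum_j f j ^+ 2.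
Proof. by rewrite (bigD1 i)//= lerDl sumr_ge0// => j _; exact: sqr_ge0. Qed.

(** Let [Q] be a unit cube at positive bounded distance from [Om].  There [v]
    vanishes, hence for [x] in [Om] and [y] in [Q] the integrand of the
    seminorm is [v x ^+ 2] times the kernel, and the kernel is at least
    [D `^ - p] when all these distances are at most [D].  Integrating over [Q],
    which has measure 1, gives the constant [D `^ p]. *)
Lemma poincare s (Om : set Rn) : (0 < n)%N -> 0 < s -> bounded_set Om ->
  exists2 C : R, 0 <= C & forall v : Rn -> R, measurable_fun setT v ->
    {ae leb, forall x, ~ Om x -> v x = 0} ->
    (\int[leb]_x (v x ^+ 2)%:E <= C%:E * gagliardo s setT v)%E.
Proof.
move=> n0 s0 [M0 [_ HM0]].
pose M := Num.max M0 0 + 1.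
have M0M : M0 < M by rewrite /M ltr_pwDr// le_max lexx.
have M0' : 0 < M by rewrite /M ltr_pwDr// le_max lexx orbT.
have OmM x i : Om x -> `|x 0 i| <= M.
  by move=> Omx; rewrite (le_trans (coord_le_norm _ _))// HM0.
pose Q : set Rn := [set x | forall i, x 0 i \in `[M + 1, (M + 1) + 1]].
have mQ : measurable Q by exact: measurable_cube.
have Q1 : leb Q = 1%E by exact: lebesgue_row_cube.
have QOm y : Q y -> ~ Om y.
  move=> Qy /(OmM _ (Ordinal n0)); have := Qy (Ordinal n0).
  by rewrite in_itv/= ler_norml => /andP[? ?] /andP[? ?]; lra.
pose D := Num.sqrt (n%:R * (2 * M + 2) ^+ 2).
pose p := n%:R + 2 * s.
have p0 : 0 <= p by rewrite addr_ge0// mulr_ge0// ltW.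
exists (D `^ p); first exact: powR_ge0.
move=> v mv v0.
have sep x y : Om x -> Q y -> 1 <= D `^ p * frac_kernel s (x, y).
  move=> Omx Qy.
  have dist i : 1 <= y 0 i - x 0 i <= 2 * M + 2.
    have := Qy i; have := OmM x i Omx; rewrite in_itv/= ler_norml.
    by move=> /andP[? ?] /andP[? ?]; lra.
  have e1 : 1 <= enorm (x - y).
    rewrite -sqrtr1 ler_sqrt; last first.
      by apply: sumr_ge0 => i _; exact: sqr_ge0.
    apply: (le_trans _ (sq_le_fin (fun i => (x - y) 0 i) (Ordinal n0))).
    by rewrite !mxE; have := dist (Ordinal n0); nra.
  have eD : enorm (x - y) <= D.
    apply: ler_wsqrtr; rewrite mulr_natl -[in leRHS](card_ord n).
    rewrite -sumr_const; apply: ler_sum => i _.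
    by rewrite !mxE; have := dist i; nra.
  rewrite /frac_kernel/= ler_pdivlMr ?mul1r; last first.
    by rewrite powR_gt0// (lt_le_trans _ e1).
  by apply: ge0_ler_powR => //; rewrite nnegrE ?(le_trans _ eD) ?(le_trans _ e1).
have mK := measurable_frac_kernel s (n := n) (R := R).
pose G (q : Rn * Rn) := frac_kernel s q * (v q.1 - v q.2) ^+ 2.
(* Since [Q] has measure 1, the squared L2 norm is a double integral. *)
pose F (q : Rn * Rn) := v q.1 ^+ 2 * \1_Q q.2.
have FE : (\int[leb]_x (v x ^+ 2)%:E =
    \int[leb]_x \int[leb]_y (F (x, y))%:E)%E.
  apply: eq_integral => x _; rewrite /F/=.
  under eq_integral do rewrite EFinM.
  rewrite ge0_integralZl ?lee_fin ?sqr_ge0//; last first.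
    by apply/measurable_EFinP; exact: measurable_indic.
  by rewrite integral_indic// setIT [X in (_ * X)%E](Q1 : _ = _) mule1.
rewrite FE gagliardoE.
(* The comparison lemma takes two right-hand terms; the second gets weight 0. *)
rewrite -[leRHS]adde0.
rewrite -[X in (_ + X)%E](mul0e (qform leb (frac_kernel s) setT setT v v)).
apply: (@le_iterated_integral _ _ _ _ R leb leb setT setT F G G (D `^ p) 0) => //.
- apply: measurable_funM; last first.
    by apply: measurableT_comp; [exact: measurable_indic|exact: measurable_snd].
  by apply: measurable_funX; exact: measurableT_comp.
- exact: measurable_qform_integrand.
- exact: measurable_qform_integrand.
- by move=> q; rewrite mulr_ge0// ?sqr_ge0// indicE.
- by move=> q; rewrite mulr_ge0// ?sqr_ge0// frac_kernel_ge0.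
- by move=> q; rewrite mulr_ge0// ?sqr_ge0// frac_kernel_ge0.
- exact: powR_ge0.
apply: filterS (v0) => x vx; apply: filterS v0 => y vy.
rewrite mul0r addr0 /F /G/= indicE.
have G0 : 0 <= D `^ p * (frac_kernel s (x, y) * (v x - v y) ^+ 2).
  by rewrite mulr_ge0 ?powR_ge0// mulr_ge0 ?sqr_ge0// frac_kernel_ge0.
have [Qy|_] := boolP (y \in Q); last by rewrite mulr0.
move/set_mem in Qy.
have [Omx|nOmx] := pselect (Om x); last first.
  by move: G0; rewrite (vx nOmx) expr0n mul0r.
rewrite (vy (QOm _ Qy)) subr0 mulr1 mulrA ler_peMl ?sqr_ge0//.
exact: sep.
Qed.

End poincare.

(** * The interaction term *)

Section interaction.
Context (R : realType) (n : nat).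
Local Notation Rn := 'rV[R]_n.
Local Notation leb := (lebesgue_row R n).
Context (J : Rn -> R).
Context (J_meas : measurable_fun setT J).
Context (J_ge0 : {ae leb, forall z, 0 <= J z}).
Context (J_int : leb.-integrable setT (EFin \o J)).

(** [J] is nonnegative only almost everywhere; its positive part makes the
    integrand nonnegative everywhere, as the comparison lemmas require. *)
Definition pos_kernel (p : Rn * Rn) : R := Num.max (J (p.1 - p.2)) 0.

Lemma pos_kernel_ge0 p : 0 <= pos_kernel p.
Proof. by rewrite le_max lexx orbT. Qed.

Lemma measurable_pos_kernel : measurable_fun setT pos_kernel.
Proof.
apply: measurable_maxr => //; apply: measurableT_comp => //.
by apply: measurable_rV_sub; [exact: measurable_fst|exact: measurable_snd].
Qed.

(** For fixed [x] the map [y |-> x - y] preserves null sets, so [J] may be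
    replaced by its positive part inside the inner integral. *)
Lemma interactionE (A B : set Rn) (g h : Rn -> R) : measurable B ->
  measurable_fun setT g -> measurable_fun setT h ->
  (\int[leb]_(x in A) \int[leb]_(y in B) (J (x - y)%R * (g x - h y) ^+ 2)%:E =
   qform leb pos_kernel A B g h)%E.
Proof.
move=> mB mg mh; apply: eq_integral => x _.
have mh2 : measurable_fun B (fun y => (g x - h y) ^+ 2).
  by apply: measurable_funTS; apply: measurable_funX; exact: measurable_funB.
have mJ : measurable_fun B (fun y => J (x - y)).
  apply: measurable_funTS; apply: measurableT_comp => //.
  exact: measurable_reflect.
apply: ae_eq_integral => //.
- by apply/measurable_EFinP; exact: measurable_funM.
- apply/measurable_EFinP; apply: measurable_funM => //.
  exact: measurable_maxr.
- apply: filterS (ae_reflect x J_ge0) => y J0 _.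
  by rewrite /pos_kernel/= max_l.
Qed.

Definition J_mass : R := fine (\int[leb]_z (Num.max (J z) 0)%:E)%E.

Lemma J_massE : (\int[leb]_z (Num.max (J z) 0)%:E = J_mass%:E)%E.
Proof.
rewrite /J_mass fineK// ge0_fin_numE; last first.
  by apply: integral_ge0 => z _; rewrite lee_fin le_max lexx orbT.
move/integrableP : J_int => [_]; apply: le_lt_trans.
apply: ge0_le_integral => //.
- by move=> z _; rewrite lee_fin le_max lexx orbT.
- by apply/measurable_EFinP; exact: measurable_maxr.
- by apply: measurableT_comp => //; exact/measurable_EFinP.
- by move=> z _; rewrite /= lee_fin ge_max normr_ge0 ler_norm.
Qed.

Lemma J_mass_ge0 : 0 <= J_mass.
Proof.
rewrite fine_ge0//; apply: integral_ge0 => z _.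
by rewrite lee_fin le_max lexx orbT.
Qed.

Let mJp : measurable_fun setT (fun z : Rn => (Num.max (J z) 0)%:E).
Proof. by apply/measurable_EFinP; exact: measurable_maxr. Qed.

Let Jp0 (z : Rn) : (0 <= (Num.max (J z) 0)%:E)%E.
Proof. by rewrite lee_fin le_max lexx orbT. Qed.

Lemma pos_kernel_mass1 x : (\int[leb]_y (pos_kernel (x, y))%:E = J_mass%:E)%E.
Proof. by rewrite -J_massE -(ge0_integral_reflect x mJp Jp0). Qed.

(** Translating by [y] is composing the reflections [x |-> y - x] and
    [z |-> 0 - z]. *)
Lemma pos_kernel_mass2 y : (\int[leb]_x (pos_kernel (x, y))%:E = J_mass%:E)%E.
Proof.
have mr : measurable_fun setT (fun z : Rn => (Num.max (J (0 - z)) 0)%:E).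
  by apply: (measurableT_comp mJp); exact: measurable_reflect.
rewrite -J_massE -(ge0_integral_reflect 0 mJp Jp0).
rewrite -(ge0_integral_reflect y mr)//.
by apply: eq_integral => x _; rewrite /pos_kernel/= sub0r opprB.
Qed.

(** Expanding with [(s - t) ^+ 2 <= 2 * s ^+ 2 + 2 * t ^+ 2] leaves two terms
    in which one variable occurs only in the kernel and can be integrated out,
    after exchanging the integrals in the second one. *)
Lemma interaction_le (A B : set Rn) (g h : Rn -> R) :
  measurable A -> measurable B ->
  measurable_fun setT g -> measurable_fun setT h ->
  (qform leb pos_kernel A B g h <=
   (2 * J_mass)%:E * (\int[leb]_x (g x ^+ 2)%:E + \int[leb]_x (h x ^+ 2)%:E))%E.
Proof.
move=> mA mB mg mh.
have mK := measurable_pos_kernel.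
pose F (p : Rn * Rn) := pos_kernel p * (g p.1 - h p.2) ^+ 2.
pose G (p : Rn * Rn) := pos_kernel p * g p.1 ^+ 2.
pose H (p : Rn * Rn) := pos_kernel p * h p.2 ^+ 2.
have F0 p : 0 <= F p by rewrite mulr_ge0 ?pos_kernel_ge0 ?sqr_ge0.
have G0 p : 0 <= G p by rewrite mulr_ge0 ?pos_kernel_ge0 ?sqr_ge0.
have H0 p : 0 <= H p by rewrite mulr_ge0 ?pos_kernel_ge0 ?sqr_ge0.
have mF : measurable_fun setT F by exact: measurable_qform_integrand.
have mG : measurable_fun setT G.
  by apply: measurable_funM => //; apply: measurable_funX; exact: measurableT_comp.
have mH : measurable_fun setT H.
  by apply: measurable_funM => //; apply: measurable_funX; exact: measurableT_comp.
have msq (u : Rn -> R) : measurable_fun setT u ->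
    measurable_fun setT (fun x => (u x ^+ 2)%:E).
  by move=> mu; apply/measurable_EFinP; exact: measurable_funX.
have sq0 (u : Rn -> R) x : (0 <= (u x ^+ 2)%:E)%E by rewrite lee_fin sqr_ge0.
have GE : (\int[leb]_x \int[leb]_y (G (x, y))%:E =
    J_mass%:E * \int[leb]_x (g x ^+ 2)%:E)%E.
  rewrite -ge0_integralZl//; [|exact: msq|by rewrite lee_fin J_mass_ge0].
  apply: eq_integral => x _; rewrite -(pos_kernel_mass1 x) muleC.
  rewrite -ge0_integralZl//.
  - by apply: eq_integral => y _; rewrite /G/= mulrC.
  - exact: (@measurable_section _ _ _ _ R pos_kernel x mK).
  - by move=> y _; rewrite lee_fin pos_kernel_ge0.
have HE : (\int[leb]_x \int[leb]_y (H (x, y))%:E =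
    J_mass%:E * \int[leb]_y (h y ^+ 2)%:E)%E.
  rewrite (@fubini_tonelli _ _ _ _ R leb leb (EFin \o H))//; last first.
    exact/measurable_EFinP.
  rewrite -ge0_integralZl//; [|exact: msq|by rewrite lee_fin J_mass_ge0].
  apply: eq_integral => y _; rewrite -(pos_kernel_mass2 y) muleC.
  rewrite -ge0_integralZl//.
  - by apply: eq_integral => x _; rewrite /H/= mulrC.
  - apply/measurable_EFinP; apply: (measurableT_comp mK); exact: pair2_measurable.
  - by move=> x _; rewrite lee_fin pos_kernel_ge0.
apply: le_trans.
  apply: (@iterated_integral_subset _ _ _ _ R leb leb A setT B setT F) => //.
apply: le_trans.
  apply: (@le_iterated_integral _ _ _ _ R leb leb setT setT F G H 2 2) => //.
  apply: aeW => x; apply: aeW => y; rewrite /F /G /H/=.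
  have := pos_kernel_ge0 (x, y); have := sqr_ge0 (g x + h y); nra.
have I0 (u : Rn -> R) : (0 <= \int[leb]_x (u x ^+ 2)%:E)%E.
  by apply: integral_ge0 => x _; exact: sq0.
by rewrite GE HE !muleA -!EFinM (ge0_muleDr _ (I0 g) (I0 h)).
Qed.

End interaction.

(** * Almost everywhere uniqueness of the components *)

Section decompositions.
Context (R : realType) (n : nat) (s1 s2 : R) (Om1 Om2 : set 'rV[R]_n).
Local Notation Rn := 'rV[R]_n.
Local Notation leb := (lebesgue_row R n).
Local Notation H := (H_space s1 s2 Om1 Om2).
Local Notation parts := (parts s1 s2 Om1 Om2).

Lemma parts_decomp u : H u -> is_decomp s1 s2 Om1 Om2 u (parts u).
Proof. by move=> Hu; exact: xgetPex. Qed.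

Lemma is_decomp_lincomb u v p q (al be : R) :
  is_decomp s1 s2 Om1 Om2 u p -> is_decomp s1 s2 Om1 Om2 v q ->
  is_decomp s1 s2 Om1 Om2 (fun x => al * u x + be * v x)
    (fun x => al * p.1 x + be * q.1 x, fun x => al * p.2 x + be * q.2 x).
Proof.
move=> [p1 p2 ->] [q1 q2 ->]; split; [exact: Hs_tilde_lincomb..|].
by apply/funext => x /=; ring.
Qed.

(** On [Om1] the second components vanish, off [Om1] the first ones do; in
    both cases the sum determines the remaining component. *)
Lemma is_decomp_unique u p q :
  measurable Om1 -> measurable Om2 -> Om1 `&` Om2 = set0 ->
  is_decomp s1 s2 Om1 Om2 u p -> is_decomp s1 s2 Om1 Om2 u q ->
  {ae leb, forall x, p.1 x = q.1 x /\ p.2 x = q.2 x}.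
Proof.
move=> m1 m2 dj [p1 p2 ->] [q1 q2 E].
apply: filterS2 (filterI (Hs_tilde_ae0 m1 p1) (Hs_tilde_ae0 m2 p2))
  (filterI (Hs_tilde_ae0 m1 q1) (Hs_tilde_ae0 m2 q2)) => x [p1x p2x] [q1x q2x].
have {}E : p.1 x + p.2 x = q.1 x + q.2 x by exact: (congr1 (@^~ x) E).
have [x1|x1] := pselect (Om1 x).
  have O2 : ~ Om2 x by move=> O2; rewrite -[False]/(set0 x) -dj.
  by move: E; rewrite p2x// q2x// !addr0.
by move: E; rewrite p1x// q1x// !add0r.
Qed.

(** The chosen components of a combination and the combination of the chosen
    components both decompose the same function. *)
Lemma parts_lincomb u v (al be : R) :
  measurable Om1 -> measurable Om2 -> Om1 `&` Om2 = set0 ->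
  H u -> H v ->
  let w := (fun x => al * u x + be * v x) in
  [/\ H w,
    {ae leb, forall x, (parts w).1 x = al * (parts u).1 x + be * (parts v).1 x} &
    {ae leb, forall x, (parts w).2 x = al * (parts u).2 x + be * (parts v).2 x}].
Proof.
move=> m1 m2 dj Hu Hv w.
have dw := is_decomp_lincomb al be (parts_decomp Hu) (parts_decomp Hv).
have Hw : H w by eexists; exact: dw.
have E := is_decomp_unique m1 m2 dj (parts_decomp Hw) dw.
by split => //; apply: filterS E => x [].
Qed.

End decompositions.

(** * The load terms *)

Section pairing.
Context d (T : measurableType d) (R : realType) (mu : {measure set T -> \bar R}).
Context (Om : set T) (f : T -> R).
Context (mOm : measurable Om).
Context (mf : measurable_fun Om f).
Context (foo : (\int[mu]_(x in Om) ((f x) ^+ 2)%:E < +oo)%E).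

(** Young's inequality with a free parameter replaces Cauchy-Schwarz: with
    [eta = 1] it gives integrability, and a small [eta] gives continuity. *)
Lemma pairing_le (v : T -> R) (V eta : R) : measurable_fun setT v ->
  (\int[mu]_x (v x ^+ 2)%:E <= V%:E)%E -> 0 < eta ->
  (\int[mu]_(x in Om) `|f x * v x|%:E <=
   (eta * fine (\int[mu]_(x in Om) ((f x) ^+ 2)%:E) + eta^-1 * V)%:E)%E.
Proof.
move=> mv vV e0.
have mvO : measurable_fun Om v by exact: measurable_funTS.
have ei0 : 0 < eta^-1 by rewrite invr_gt0.
have mv2 : measurable_fun setT (fun x => (v x ^+ 2)%:E).
  by apply/measurable_EFinP; exact: measurable_funX.
apply: (@le_trans _ _ (eta%:E * \int[mu]_(x in Om) (f x ^+ 2)%:E +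
    eta^-1%:E * \int[mu]_(x in Om) (v x ^+ 2)%:E)%E).
  apply: ae_ge0_le_integral_lincomb => //.
  - apply/measurable_EFinP; apply: measurableT_comp => //.
    exact: measurable_funM.
  - by apply/measurable_EFinP; exact: measurable_funX.
  - exact: measurable_funTS.
  - by move=> x _; rewrite lee_fin sqr_ge0.
  - by move=> x _; rewrite lee_fin sqr_ge0.
  - exact: ltW.
  - exact: ltW.
  - apply: aeW => x _; rewrite -!EFinM -EFinD lee_fin.
    (* Multiply by [eta] and complete the square of [eta * |f| - |v|]. *)
    rewrite normrM -(real_normK (num_real (f x))) -(real_normK (num_real (v x))).
    rewrite -(ler_pM2l e0) mulrDr [X in _ <= _ + X]mulrA divff ?gt_eqF// mul1r.
    have := sqr_ge0 (eta * `|f x| - `|v x|).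
    have := sqr_ge0 (eta * `|f x|); have := sqr_ge0 `|v x|; nra.
rewrite EFinD !EFinM fineK; last first.
  rewrite ge0_fin_numE//; apply: integral_ge0 => x _; by rewrite lee_fin sqr_ge0.
apply: leeD => //; apply: lee_wpmul2l; first by rewrite lee_fin ltW.
apply: le_trans vV; apply: ge0_subset_integral => //.
by move=> x _; rewrite lee_fin sqr_ge0.
Qed.

Lemma pairing_integrable (v : T -> R) : measurable_fun setT v ->
  (\int[mu]_x (v x ^+ 2)%:E < +oo)%E ->
  mu.-integrable Om (fun x => (f x * v x)%:E).
Proof.
move=> mv voo; apply/integrableP; split.
  by apply/measurable_EFinP; apply: measurable_funM => //; exact: measurable_funTS.
have vfin : (\int[mu]_x (v x ^+ 2)%:E)%E \is a fin_num.
  by rewrite ge0_fin_numE//; apply: integral_ge0 => x _; rewrite lee_fin sqr_ge0.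
have := pairing_le mv (V := fine (\int[mu]_x (v x ^+ 2)%:E)%E) _ ltr01.
rewrite fineK// => /(_ (lexx _)) h.
by apply: le_lt_trans h _; rewrite ltry.
Qed.

Lemma pairing_norm_le (v : T -> R) (V eta : R) : measurable_fun setT v ->
  (\int[mu]_x (v x ^+ 2)%:E <= V%:E)%E -> 0 < eta ->
  `|\int[mu]_(x in Om) (f x * v x)| <=
   eta * fine (\int[mu]_(x in Om) ((f x) ^+ 2)%:E)%E + eta^-1 * V.
Proof.
move=> mv vV e0.
have voo : (\int[mu]_x (v x ^+ 2)%:E < +oo)%E by rewrite (le_lt_trans vV) ?ltry.
have i := pairing_integrable mv voo.
apply: le_trans (le_normr_Rintegral mOm i) _.
have := pairing_le mv vV e0.
have ifin : (\int[mu]_(x in Om) `|f x * v x|%:E)%E \is a fin_num.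
  rewrite ge0_fin_numE; first by have /integrableP[] := i.
  exact: integral_ge0.
by rewrite -lee_fin /Rintegral fineK.
Qed.

Lemma pairing_lincomb (v v1 v2 : T -> R) (al be : R) :
  measurable_fun setT v -> measurable_fun setT v1 -> measurable_fun setT v2 ->
  (\int[mu]_x (v1 x ^+ 2)%:E < +oo)%E -> (\int[mu]_x (v2 x ^+ 2)%:E < +oo)%E ->
  {ae mu, forall x, v x = al * v1 x + be * v2 x} ->
  \int[mu]_(x in Om) (f x * v x) =
  al * \int[mu]_(x in Om) (f x * v1 x) + be * \int[mu]_(x in Om) (f x * v2 x).
Proof.
move=> mv mv1 mv2 v1oo v2oo vE.
have i1 := pairing_integrable mv1 v1oo; have i2 := pairing_integrable mv2 v2oo.
have mfv (u : T -> R) : measurable_fun setT u ->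
    measurable_fun Om (fun x => f x * u x).
  by move=> mu'; apply: measurable_funM => //; exact: measurable_funTS.
rewrite -RintegralZl// -RintegralZl// -RintegralD//.
- congr fine; apply: ae_eq_integral => //.
  + exact/measurable_EFinP/mfv.
  + by apply/measurable_EFinP; apply: measurable_funD;
      apply: measurable_funM => //; exact: mfv.
  + by apply: filterS vE => x /= -> _; congr EFin; ring.
- exact: (integrableZl mOm al i1).
- exact: (integrableZl mOm be i2).
Qed.

End pairing.

(** * Scalar inequalities behind continuity *)

Lemma young_sqr (R : realType) (eta s t : R) : 0 < eta ->
  (s + t) ^+ 2 <= (1 + eta) * s ^+ 2 + (1 + eta^-1) * t ^+ 2.
Proof.
move=> e0; rewrite -(ler_pM2l e0) mulrDr [eta * (_ * t ^+ 2)]mulrA.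
rewrite [eta * (1 + eta^-1)]mulrDr mulr1 divff ?gt_eqF//.
have := sqr_ge0 (eta * s - t); nra.
Qed.

(** Here [A], [q] and [r] are the energies of [u], [v] and [v - u], [l] is the
    load applied to [v - u] and [N] its norm.  First [eta] is chosen so that
    the terms proportional to [eta], at most [eta * (2 * A + F)], stay below
    [e / 2]; then [del] is chosen so that the terms carrying [eta^-1], at most
    [5 * eta^-1 * C * N ^+ 2], stay below [e / 2]. *)
Lemma continuity_modulus (R : realType) (e A F C : R) :
  0 < e -> 0 <= A -> 0 <= F -> 0 <= C ->
  exists2 del : R, 0 < del & forall q r l N : R,
    0 <= N < del -> 0 <= r <= C * N ^+ 2 ->
    (forall eta, 0 < eta -> q <= (1 + eta) * A + (1 + eta^-1) * r) ->
    (forall eta, 0 < eta -> A <= (1 + eta) * q + (1 + eta^-1) * r) ->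
    (forall eta, 0 < eta -> `|l| <= eta * F + eta^-1 * (C * N ^+ 2)) ->
    `|q - A - l| < e.
Proof.
move=> e0 A0 F0 C0.
pose eta := Num.min 1 (e / (2 * (2 * A + F + 1))).
have k0 : 0 < 2 * (2 * A + F + 1) by lra.
have eta0 : 0 < eta by rewrite lt_min ltr01 divr_gt0.
have eta1 : eta <= 1 by rewrite ge_min lexx.
have etaA : eta * (2 * A + F + 1) <= e / 2.
  have : eta <= e / (2 * (2 * A + F + 1)) by rewrite ge_min lexx orbT.
  by rewrite ler_pdivlMr//; lra.
pose D := e * eta / (10 * (C + 1)).
have c0 : 0 < 10 * (C + 1) by lra.
have D0 : 0 < D by rewrite divr_gt0// mulr_gt0.
exists (Num.sqrt D); first by rewrite sqrtr_gt0.
move=> q r l N /andP[N0 ND] /andP[r0 rC].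
move=> /(_ _ eta0) h1 /(_ _ eta0) h2 /(_ _ eta0) h3.
have N2 : N ^+ 2 < D.
  by rewrite -(sqr_sqrtr (ltW D0)) ltr_pXn2r// nnegrE sqrtr_ge0.
pose S := eta^-1 * (C * N ^+ 2).
have i1 : 1 <= eta^-1 by rewrite invf_ge1.
have S5 : 5 * S <= e / 2.
  have eS : eta * S = C * N ^+ 2 by rewrite mulrA divff ?gt_eqF// mul1r.
  rewrite -(ler_pM2l eta0) mulrCA eS.
  have : N ^+ 2 * (10 * (C + 1)) <= e * eta by rewrite -ler_pdivlMr// ltW.
  have := sqr_ge0 N; nra.
have rS : eta^-1 * r <= S by rewrite /S ler_pM2l ?invr_gt0.
have rr : r <= eta^-1 * r by rewrite ler_peMl.
rewrite -/S in h3.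
have eA : 0 <= eta * A by rewrite mulr_ge0// ltW.
have h1' : q - A <= 2 * (eta * A) + 2 * S by nra.
have er : eta * q <= 2 * (eta * A) + 2 * S.
  have : eta * q <= eta * ((1 + eta) * A + (1 + eta^-1) * r) by rewrite ler_pM2l.
  have -> : eta * ((1 + eta) * A + (1 + eta^-1) * r) =
    eta * A + eta * (eta * A) + eta * r + (eta * eta^-1) * r by ring.
  rewrite divff ?gt_eqF// mul1r.
  have : eta * (eta * A) <= eta * A by rewrite ler_piMl.
  have : eta * r <= r by rewrite ler_piMl.
  lra.
have h2' : A - q <= 2 * (eta * A) + 4 * S by nra.
have h3' : `|l| <= eta * F + S by [].
have : eta * (2 * A + F + 1) = 2 * (eta * A) + eta * F + eta by ring.
move: h3'; rewrite ler_norml ltr_norml => /andP[? ?] ?.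
by apply/andP; split; lra.
Qed.

(** * The energy functional *)

Section energy_functional.
Context (R : realType) (n : nat) (s1 s2 : R) (Om1 Om2 : set 'rV[R]_n).
Context (J f1 f2 : 'rV[R]_n -> R).
Local Notation Rn := 'rV[R]_n.
Local Notation leb := (lebesgue_row R n).
Local Notation H := (H_space s1 s2 Om1 Om2).
Local Notation parts := (parts s1 s2 Om1 Om2).
Context (n_gt0 : (0 < n)%N) (s1_gt0 : 0 < s1) (s2_gt0 : 0 < s2).
Context (mOm1 : measurable Om1) (mOm2 : measurable Om2).
Context (bOm1 : bounded_set Om1) (bOm2 : bounded_set Om2).
Context (dj : Om1 `&` Om2 = set0).
Context (J_meas : measurable_fun setT J).
Context (J_ge0 : {ae leb, forall z, 0 <= J z}).
Context (J_int : leb.-integrable setT (EFin \o J)).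
Context (f1_L2 : L2_on Om1 f1) (f2_L2 : L2_on Om2 f2).

(** The comparison of energies multiplies inequalities by these weights; each
    factor of the constant is nonnegative. *)
Lemma frac_laplacian_const_ge0 (s : R) : 0 < s -> 0 <= frac_laplacian_const n s.
Proof.
move=> s0.
have G0 (a : R) : 0 <= euler_Gamma a.
  by apply: Rintegral_ge0 => t _; rewrite mulr_ge0 ?powR_ge0 ?expR_ge0.
by rewrite divr_ge0// ?mulr_ge0 ?powR_ge0// ltW.
Qed.

Definition energy_weight (s : R) : R := frac_laplacian_const n s / 2 / 2.

Lemma energy_weight_ge0 (s : R) : 0 < s -> 0 <= energy_weight s.
Proof.
by move=> s0; do 2 apply: divr_ge0 => //; exact: frac_laplacian_const_ge0.
Qed.

Let w1_ge0 := energy_weight_ge0 s1_gt0.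
Let w2_ge0 := energy_weight_ge0 s2_gt0.

Let half0 : 0 <= 2^-1 :> R.
Proof. by rewrite invr_ge0. Qed.

(** The energy as a function of an arbitrary pair of components, so that it
    can be compared across pairs that agree only almost everywhere. *)
Definition quad_energy (p : (Rn -> R) * (Rn -> R)) : \bar R :=
  ((energy_weight s1)%:E * gagliardo s1 (~` Om2) p.1
   + (energy_weight s2)%:E * gagliardo s2 (~` Om1) p.2
   + (2^-1)%:E * qform leb (pos_kernel J) Om1 Om2 p.1 p.2)%E.

Definition load (p : (Rn -> R) * (Rn -> R)) : R :=
  \int[leb]_(x in Om1) (f1 x * p.1 x) + \int[leb]_(x in Om2) (f2 x * p.2 x).

Definition pair_sqnorm (p : (Rn -> R) * (Rn -> R)) : \bar R :=
  (gagliardo s1 setT p.1 + gagliardo s2 setT p.2)%E.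

Definition admissible (p : (Rn -> R) * (Rn -> R)) :=
  Hs_tilde s1 Om1 p.1 /\ Hs_tilde s2 Om2 p.2.

Lemma parts_admissible u : H u -> admissible (parts u).
Proof. by move=> /parts_decomp[]. Qed.

Lemma energyE u : H u -> energy s1 s2 Om1 Om2 J u = quad_energy (parts u).
Proof.
move=> /parts_admissible[/Hs_tilde_measurable m1 /Hs_tilde_measurable m2].
by rewrite /quad_energy -(interactionE J_meas J_ge0 Om1 mOm2 m1 m2).
Qed.

Lemma quad_energy_ge0 p : (0 <= quad_energy p)%E.
Proof.
have P0 := qform_ge0 leb Om1 Om2 p.1 p.2 (pos_kernel_ge0 J).
have X0 := gagliardo_ge0 s1 (~` Om2) p.1.
have Y0 := gagliardo_ge0 s2 (~` Om1) p.2.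
exact: (adde_ge0 (adde_ge0 (EFin_mule_ge0 w1_ge0 X0) (EFin_mule_ge0 w2_ge0 Y0))
  (EFin_mule_ge0 half0 P0)).
Qed.

Lemma quad_energy_comb p p1 p2 (al be a b : R) :
  admissible p -> admissible p1 -> admissible p2 -> 0 <= a -> 0 <= b ->
  (forall s t, (al * s + be * t) ^+ 2 <= a * s ^+ 2 + b * t ^+ 2) ->
  {ae leb, forall x, p.1 x = al * p1.1 x + be * p2.1 x} ->
  {ae leb, forall x, p.2 x = al * p1.2 x + be * p2.2 x} ->
  (quad_energy p <= a%:E * quad_energy p1 + b%:E * quad_energy p2)%E.
Proof.
move=> [/Hs_tilde_measurable m1 /Hs_tilde_measurable m2].
move=> [/Hs_tilde_measurable m11 /Hs_tilde_measurable m12].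
move=> [/Hs_tilde_measurable m21 /Hs_tilde_measurable m22] a0 b0 ab E1 E2.
have K0 := @frac_kernel_ge0 R n.
have mK s := measurable_frac_kernel s (n := n) (R := R).
have mC1 : measurable (~` Om1) by exact: measurableC.
have mC2 : measurable (~` Om2) by exact: measurableC.
have P0 := pos_kernel_ge0 J; have mP := measurable_pos_kernel J_meas.
rewrite /quad_energy !gagliardoE.
have X0 (g : Rn -> R) := qform_ge0 leb (~` Om2) (~` Om2) g g (K0 s1).
have Y0 (g : Rn -> R) := qform_ge0 leb (~` Om1) (~` Om1) g g (K0 s2).
have Z0 (g h : Rn -> R) := qform_ge0 leb Om1 Om2 g h P0.
have X := @qform_comb _ _ _ leb (frac_kernel s1) (~` Om2) (~` Om2) p.1 p.1
  p1.1 p1.1 p2.1 p2.1 al be a b mC2 mC2 (mK s1) (K0 s1) m1 m1 m11 m11 m21 m21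
  a0 b0 ab E1 E1.
have Y := @qform_comb _ _ _ leb (frac_kernel s2) (~` Om1) (~` Om1) p.2 p.2
  p1.2 p1.2 p2.2 p2.2 al be a b mC1 mC1 (mK s2) (K0 s2) m2 m2 m12 m12 m22 m22
  a0 b0 ab E2 E2.
have Z := @qform_comb _ _ _ leb (pos_kernel J) Om1 Om2 p.1 p.2
  p1.1 p1.2 p2.1 p2.2 al be a b mOm1 mOm2 mP P0 m1 m2 m11 m12 m21 m22
  a0 b0 ab E1 E2.
have X' := lee_lincombM a0 b0 w1_ge0 (X0 p1.1) (X0 p2.1) X.
have Y' := lee_lincombM a0 b0 w2_ge0 (Y0 p1.2) (Y0 p2.2) Y.
have Z' := lee_lincombM a0 b0 half0 (Z0 p1.1 p1.2) (Z0 p2.1 p2.2) Z.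
have XY := lee_lincombD
  (EFin_mule_ge0 w1_ge0 (X0 p1.1)) (EFin_mule_ge0 w1_ge0 (X0 p2.1))
  (EFin_mule_ge0 w2_ge0 (Y0 p1.2)) (EFin_mule_ge0 w2_ge0 (Y0 p2.2)) X' Y'.
apply: lee_lincombD XY Z'.
- exact: (adde_ge0 (EFin_mule_ge0 w1_ge0 (X0 p1.1))
    (EFin_mule_ge0 w2_ge0 (Y0 p1.2))).
- exact: (adde_ge0 (EFin_mule_ge0 w1_ge0 (X0 p2.1))
    (EFin_mule_ge0 w2_ge0 (Y0 p2.2))).
- exact: (EFin_mule_ge0 half0 (Z0 p1.1 p1.2)).
- exact: (EFin_mule_ge0 half0 (Z0 p2.1 p2.2)).
Qed.

Lemma pair_sqnorm_fin p : admissible p -> pair_sqnorm p \is a fin_num.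
Proof.
move=> [[[_ p1oo] _] [[_ p2oo] _]]; rewrite ge0_fin_numE; last first.
  by apply: adde_ge0; exact: gagliardo_ge0.
apply: lte_add_pinfty; [apply: le_lt_trans p1oo|apply: le_lt_trans p2oo];
  rewrite leeDr//; apply: integral_ge0 => x _; by rewrite lee_fin sqr_ge0.
Qed.

Lemma pair_sqnorm_ge0 p : (0 <= pair_sqnorm p)%E.
Proof. by apply: adde_ge0; exact: gagliardo_ge0. Qed.

Lemma L2_fin1 p : admissible p -> (\int[leb]_x (p.1 x ^+ 2)%:E < +oo)%E.
Proof.
move=> [[[_ p1oo] _] _]; apply: le_lt_trans p1oo.
by rewrite leeDl// gagliardo_ge0.
Qed.

Lemma L2_fin2 p : admissible p -> (\int[leb]_x (p.2 x ^+ 2)%:E < +oo)%E.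
Proof.
move=> [_ [[_ p2oo] _]]; apply: le_lt_trans p2oo.
by rewrite leeDl// gagliardo_ge0.
Qed.

(** The norm of [H] carries no L2 part; this is where the Poincare inequality
    restores it.  Both the finiteness and the continuity of the energy follow
    from these bounds. *)
Lemma pair_sqnorm_controls : exists2 C : R, 0 <= C & forall p, admissible p ->
  [/\ (quad_energy p <= C%:E * pair_sqnorm p)%E,
      (\int[leb]_x (p.1 x ^+ 2)%:E <= C%:E * pair_sqnorm p)%E &
      (\int[leb]_x (p.2 x ^+ 2)%:E <= C%:E * pair_sqnorm p)%E].
Proof.
have [P1 P10 HP1] := poincare n_gt0 s1_gt0 bOm1.
have [P2 P20 HP2] := poincare n_gt0 s2_gt0 bOm2.
rewrite /quad_energy /pair_sqnorm.
have jle := interaction_le J_meas J_int mOm1 mOm2.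
move: (J_mass J) (J_mass_ge0 J) jle => j j0 jle.
move: (energy_weight s1) (energy_weight s2) (energy_weight_ge0 s1_gt0)
  (energy_weight_ge0 s2_gt0) => c1 c2 c10 c20.
pose P := P1 + P2.
have P0 : 0 <= P by exact: addr_ge0.
have jP0 : 0 <= 2 * j * P by rewrite mulr_ge0// mulr_ge0.
pose C := c1 + c2 + 2 * j * P + P.
have C0 : 0 <= C := addr_ge0 (addr_ge0 (addr_ge0 c10 c20) jP0) P0.
exists C => // p adm.
have [h1 h2] := adm.
have m1 := Hs_tilde_measurable h1; have m2 := Hs_tilde_measurable h2.
have i1 := HP1 _ m1 (Hs_tilde_ae0 mOm1 h1).
have i2 := HP2 _ m2 (Hs_tilde_ae0 mOm2 h2).
have mC1 : measurable (~` Om1) by exact: measurableC.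
have mC2 : measurable (~` Om2) by exact: measurableC.
have g1 := gagliardo_subset s1 mC2 m1.
have g2 := gagliardo_subset s2 mC1 m2.
have z1 := gagliardo_ge0 s1 setT p.1.
have z2 := gagliardo_ge0 s2 setT p.2.
move: (jle _ _ m1 m2) (pair_sqnorm_fin adm) i1 i2 g1 g2 z1 z2.
rewrite /pair_sqnorm fin_numD.
move: (qform _ _ _ _ _ _) (gagliardo s1 (~` Om2) _) (gagliardo s2 (~` Om1) _).
move: (gagliardo s1 setT _) (gagliardo s2 setT _).
move: (\int[leb]_x (p.1 x ^+ 2)%:E)%E (\int[leb]_x (p.2 x ^+ 2)%:E)%E.
move=> u1 u2 [x| |]// [y| |]// q gx gy qle _ u1x u2y gxx gyy x0 y0.
rewrite !lee_fin in x0 y0; rewrite -EFinM in u1x; rewrite -EFinM in u2y.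
have xy0 : 0 <= x + y by exact: addr_ge0.
have Pxy0 : 0 <= P * (x + y) by exact: mulr_ge0.
have CE : C * (x + y) = c1 * x + c1 * y + c2 * x + c2 * y
    + 2 * j * (P * (x + y)) + P * (x + y) by rewrite /C; ring.
have c1y : 0 <= c1 * y by exact: mulr_ge0.
have c2x : 0 <= c2 * x by exact: mulr_ge0.
have c1x : 0 <= c1 * x by exact: mulr_ge0.
have c2y : 0 <= c2 * y by exact: mulr_ge0.
have jPxy : 0 <= 2 * j * (P * (x + y)) by rewrite mulr_ge0// mulr_ge0.
have PC : P * (x + y) <= C * (x + y) by rewrite CE; lra.
have u1P : (u1 <= (P * (x + y))%:E)%E.
  by apply: le_trans u1x _; rewrite lee_fin /P; nra.
have u2P : (u2 <= (P * (x + y))%:E)%E.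
  by apply: le_trans u2y _; rewrite lee_fin /P; nra.
rewrite -EFinD -EFinM; split.
- (* The L2 norms in the interaction bound are replaced by [P * (x + y)]. *)
  have qP : (q <= (2 * j * (P * (x + y) + P * (x + y)))%:E)%E.
    apply: le_trans qle _; rewrite EFinM EFinD; apply: lee_wpmul2l (leeD u1P u2P).
    by rewrite lee_fin mulr_ge0.
  have w (c : R) (a : \bar R) (b : R) : 0 <= c -> (a <= b%:E)%E ->
      (c%:E * a <= (c * b)%:E)%E.
    by move=> c0 ab; rewrite EFinM; apply: lee_wpmul2l => //; rewrite lee_fin.
  apply: le_trans (leeD (leeD (w _ _ _ c10 gxx) (w _ _ _ c20 gyy))
    (w _ _ _ half0 qP)) _.
  rewrite -!EFinD lee_fin CE.
  have -> : 2^-1 * (2 * j * (P * (x + y) + P * (x + y))) =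
    2 * j * (P * (x + y)) by field.
  lra.
- by apply: le_trans u1P _; rewrite lee_fin.
- by apply: le_trans u2P _; rewrite lee_fin.
Qed.

Lemma quad_energy_fin p : admissible p -> quad_energy p \is a fin_num.
Proof.
move=> adm; have [C C0 /(_ _ adm)[h _ _]] := pair_sqnorm_controls.
rewrite ge0_fin_numE ?quad_energy_ge0// (le_lt_trans h)//.
by rewrite -(fineK (pair_sqnorm_fin adm)) -EFinM ltry.
Qed.

Lemma energy_finite u : H u -> total_energy_finite s1 s2 Om1 Om2 J f1 f2 u.
Proof.
move=> Hu; have adm := parts_admissible Hu.
have [/Hs_tilde_measurable m1 /Hs_tilde_measurable m2] := adm.
have [mf1 f1oo] := f1_L2; have [mf2 f2oo] := f2_L2.
split; first by rewrite energyE// quad_energy_fin.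
- by apply: pairing_integrable => //; exact: L2_fin1.
- by apply: pairing_integrable => //; exact: L2_fin2.
Qed.

Lemma total_energyE u : H u ->
  total_energy s1 s2 Om1 Om2 J f1 f2 u =
  fine (quad_energy (parts u)) - load (parts u).
Proof. by move=> Hu; rewrite /total_energy energyE// /load opprD addrA. Qed.

Lemma load_comb p p1 p2 (al be : R) :
  admissible p -> admissible p1 -> admissible p2 ->
  {ae leb, forall x, p.1 x = al * p1.1 x + be * p2.1 x} ->
  {ae leb, forall x, p.2 x = al * p1.2 x + be * p2.2 x} ->
  load p = al * load p1 + be * load p2.
Proof.
move=> adm adm1 adm2 E1 E2; rewrite /load.
have [/Hs_tilde_measurable m1 /Hs_tilde_measurable m2] := adm.
have [/Hs_tilde_measurable m11 /Hs_tilde_measurable m12] := adm1.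
have [/Hs_tilde_measurable m21 /Hs_tilde_measurable m22] := adm2.
have [mf1 f1oo] := f1_L2; have [mf2 f2oo] := f2_L2.
rewrite (pairing_lincomb mOm1 mf1 f1oo m1 m11 m21
  (L2_fin1 adm1) (L2_fin1 adm2) E1).
rewrite (pairing_lincomb mOm2 mf2 f2oo m2 m12 m22
  (L2_fin2 adm1) (L2_fin2 adm2) E2).
by ring.
Qed.

Lemma quad_energy_fine_comb p p1 p2 (al be a b : R) :
  admissible p -> admissible p1 -> admissible p2 -> 0 <= a -> 0 <= b ->
  (forall s t, (al * s + be * t) ^+ 2 <= a * s ^+ 2 + b * t ^+ 2) ->
  {ae leb, forall x, p.1 x = al * p1.1 x + be * p2.1 x} ->
  {ae leb, forall x, p.2 x = al * p1.2 x + be * p2.2 x} ->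
  fine (quad_energy p) <= a * fine (quad_energy p1) + b * fine (quad_energy p2).
Proof.
move=> adm adm1 adm2 a0 b0 ab E1 E2.
have := quad_energy_comb adm adm1 adm2 a0 b0 ab E1 E2.
move: (quad_energy_fin adm) (quad_energy_fin adm1) (quad_energy_fin adm2).
by case: (quad_energy p) (quad_energy p1) (quad_energy p2) => [x| |] [y| |] [z| |].
Qed.

Lemma total_energy_convex (u v : Rn -> R) (t : R) : 0 <= t <= 1 -> H u -> H v ->
  total_energy s1 s2 Om1 Om2 J f1 f2 (fun x => t * u x + (1 - t) * v x) <=
  t * total_energy s1 s2 Om1 Om2 J f1 f2 u +
  (1 - t) * total_energy s1 s2 Om1 Om2 J f1 f2 v.
Proof.
move=> /andP[t0 t1] Hu Hv.
have [Hw E1 E2] := parts_lincomb t (1 - t) mOm1 mOm2 dj Hu Hv.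
rewrite !total_energyE//.
have au := parts_admissible Hu; have av := parts_admissible Hv.
have aw := parts_admissible Hw.
rewrite (load_comb aw au av E1 E2).
have t1' : 0 <= 1 - t by rewrite subr_ge0.
have sq x y : (t * x + (1 - t) * y) ^+ 2 <= t * x ^+ 2 + (1 - t) * y ^+ 2.
  rewrite -subr_ge0.
  have -> : t * x ^+ 2 + (1 - t) * y ^+ 2 - (t * x + (1 - t) * y) ^+ 2 =
    t * (1 - t) * (x - y) ^+ 2 by ring.
  by rewrite mulr_ge0 ?sqr_ge0// mulr_ge0.
have key (q q1 q2 l1 l2 : R) : q <= t * q1 + (1 - t) * q2 ->
    q - (t * l1 + (1 - t) * l2) <= t * (q1 - l1) + (1 - t) * (q2 - l2).
  by move=> h; lra.
exact: (key _ _ _ _ _ (quad_energy_fine_comb aw au av t0 t1' sq E1 E2)).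
Qed.

Lemma total_energy_continuous :
  @continuous_on (Rn -> R^o) R (H_norm s1 s2 Om1 Om2) H
    (total_energy s1 s2 Om1 Om2 J f1 f2).
Proof.
move=> u Hu e e0.
have [C C0 HC] := pair_sqnorm_controls.
have [mf1 f1oo] := f1_L2; have [mf2 f2oo] := f2_L2.
pose F := fine (\int[leb]_(x in Om1) (f1 x ^+ 2)%:E)%E +
          fine (\int[leb]_(x in Om2) (f2 x ^+ 2)%:E)%E.
have F0 : 0 <= F.
  by apply: addr_ge0; apply: fine_ge0; apply: integral_ge0 => x _;
    rewrite lee_fin sqr_ge0.
have q0 p : 0 <= fine (quad_energy p) by rewrite fine_ge0// quad_energy_ge0.
(* Each of the two loads is bounded with the constant [C], hence [2 * C]. *)
have C20 : 0 <= 2 * C by rewrite mulr_ge0.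
have [del del0 Hdel] := continuity_modulus e0 (q0 (parts u)) F0 C20.
exists del => // v Hv Ndel.
have au := parts_admissible Hu; have av := parts_admissible Hv.
have wE : v - u = (fun x => 1 * v x + (-1) * u x).
  by apply/funext => x; rewrite mul1r mulN1r.
have [Hw E1 E2] := parts_lincomb 1 (-1) mOm1 mOm2 dj Hv Hu.
rewrite -wE in Hw E1 E2; set w := v - u in Ndel Hw E1 E2.
have aw := parts_admissible Hw.
have vE1 : {ae leb, forall x,
    (parts v).1 x = 1 * (parts u).1 x + 1 * (parts w).1 x}.
  by apply: filterS E1 => x ->; ring.
have vE2 : {ae leb, forall x,
    (parts v).2 x = 1 * (parts u).2 x + 1 * (parts w).2 x}.
  by apply: filterS E2 => x ->; ring.
have uE1 : {ae leb, forall x,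
    (parts u).1 x = 1 * (parts v).1 x + (-1) * (parts w).1 x}.
  by apply: filterS E1 => x ->; ring.
have uE2 : {ae leb, forall x,
    (parts u).2 x = 1 * (parts v).2 x + (-1) * (parts w).2 x}.
  by apply: filterS E2 => x ->; ring.
rewrite !total_energyE//.
rewrite (load_comb av au aw vE1 vE2) !mul1r.
have diffE (q a l1 l : R) : q - (l1 + l) - (a - l1) = q - a - l by ring.
rewrite diffE.
have g0 : 0 <= fine (pair_sqnorm (parts w)) by rewrite fine_ge0// pair_sqnorm_ge0.
have N2 : H_norm s1 s2 Om1 Om2 w ^+ 2 = fine (pair_sqnorm (parts w)).
  by rewrite sqr_sqrtr.
have [b0 b1 b2] := HC _ aw.
rewrite -(fineK (pair_sqnorm_fin aw)) -EFinM in b0 b1 b2.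
apply: (Hdel _ (fine (quad_energy (parts w))) _ (H_norm s1 s2 Om1 Om2 w)).
- by rewrite sqrtr_ge0 Ndel.
- rewrite q0 N2/=.
  move: b0; rewrite -(fineK (quad_energy_fin aw)) lee_fin => /le_trans; apply.
  by apply: ler_wpM2r => //; lra.
- move=> eta eta0; apply: (quad_energy_fine_comb av au aw _ _ _ vE1 vE2).
  + by rewrite addr_ge0// ltW.
  + by rewrite addr_ge0// invr_ge0 ltW.
  + by move=> x y; rewrite !mul1r; exact: young_sqr.
- move=> eta eta0; apply: (quad_energy_fine_comb au av aw _ _ _ uE1 uE2).
  + by rewrite addr_ge0// ltW.
  + by rewrite addr_ge0// invr_ge0 ltW.
  + move=> x y; rewrite mul1r mulN1r -(sqrrN y); exact: young_sqr.
- move=> eta eta0; rewrite N2.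
  have [/Hs_tilde_measurable m1 /Hs_tilde_measurable m2] := aw.
  have l1 := pairing_norm_le mOm1 mf1 f1oo m1 b1 eta0.
  have l2 := pairing_norm_le mOm2 mf2 f2oo m2 b2 eta0.
  apply: le_trans (ler_normD _ _) _.
  apply: le_trans (lerD l1 l2) _.
  by rewrite le_eqVlt; apply/orP; left; apply/eqP; rewrite /F; ring.
Qed.

End energy_functional.

Unset Implicit Arguments.
Set Strict Implicit.

Theorem lemma3p2 (R : realType) (n : nat) (s1 s2 : R)
  (Om1 Om2 : set 'rV[R]_n) (J f1 f2 : 'rV[R]_n -> R)
  (n_ge2 : (2 <= n)%N)
  (s1_01 : 0 < s1 < 1) (s2_01 : 0 < s2 < 1)
  (dom1 : lipschitz_domain Om1) (dom2 : lipschitz_domain Om2)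
  (disj : closure Om1 `&` closure Om2 = set0)
  (d_gt0 : (0 < set_dist Om1 Om2)%E)
  (J_meas : measurable_fun setT J)
  (J_ge0 : {ae lebesgue_row R n, forall z, 0 <= J z})
  (J_sym : {ae lebesgue_row R n, forall z, J z = J (- z)})
  (J_int : (lebesgue_row R n).-integrable setT (EFin \o J))
  (J_supp : exists r : R, (set_dist Om1 Om2 < r%:E)%E /\
     eball 0 r `<=` ess_support J)
  (f1_L2 : L2_on Om1 f1) (f2_L2 : L2_on Om2 f2) :
  [/\ forall u, H_space s1 s2 Om1 Om2 u ->
        total_energy_finite s1 s2 Om1 Om2 J f1 f2 u,
      @convex_function R ('rV[R]_n -> R^o) (H_space s1 s2 Om1 Om2)
        (total_energy s1 s2 Om1 Om2 J f1 f2) &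
      @continuous_on ('rV[R]_n -> R^o) R (H_norm s1 s2 Om1 Om2)
        (H_space s1 s2 Om1 Om2) (total_energy s1 s2 Om1 Om2 J f1 f2)].
Proof.
have n_gt0 : (0 < n)%N by exact: ltn_trans n_ge2.
have [s1_gt0 _] := andP s1_01; have [s2_gt0 _] := andP s2_01.
have [_ oOm1 _ bOm1 _] := dom1; have [_ oOm2 _ bOm2 _] := dom2.
have mOm1 := open_measurable_rV oOm1; have mOm2 := open_measurable_rV oOm2.
have dj : Om1 `&` Om2 = set0.
  by rewrite -subset0 -disj; apply: setISS; exact: subset_closure.
split.
- by move=> u; exact: energy_finite.
- move=> t u v /set_mem Hu /set_mem Hv.
  by apply: total_energy_convex => //; rewrite ge0 le1.
- exact: total_energy_continuous.
Qed.
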